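(* Let $p>1$, $a\in\mathbb{R}$, and $R\ge 1$. Let $(f,g)\in C_0^2(\mathbb{R})\times C_0^1(\mathbb{R})$ satisfy $\operatorname{supp} f,\ \operatorname{supp} g\subset\{x\in\mathbb{R}:|x|\le R\}$. Then there exist a constant $\varepsilon_2=\varepsilon_2(f,g,p,a,R)>0$ and a constant $C>0$ independent of $\varepsilon$ such that, for every $\varepsilon\in(0,\varepsilon_2]$, the classical solution of the Cauchy problem $$u_{tt}-u_{xx}=\frac{|u_x|^p}{\langle x\rangle^a}\ \text{ in }\mathbb{R}\times(0,T),\qquad u(x,0)=\varepsilon f(x),\quad u_t(x,0)=\varepsilon g(x),\quad x\in\mathbb{R},$$ exists on the time interval $[0,T)$ whenever $T>0$ satisfies $$T<\begin{cases} C\varepsilon^{-(p-1)/(1-a)} & \text{if } a<1,\\ \exp\left(C\varepsilon^{-(p-1)}\right) & \text{if } a=1,\\ \infty & \text{if } a>1.\end{cases}$$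
   Context: Notation: $\langle x\rangle=(1+x^2)^{1/2}$ for $x\in\mathbb{R}$. $C_0^k(\mathbb{R})$ denotes the $C^k$ functions with compact support. A classical solution on the time interval $[0,T)$ is a real-valued function $u=u(x,t)\in C^2(\mathbb{R}\times[0,T))$ satisfying the equation and the initial conditions pointwise. *)

(* Defs.v *)
From Stdlib Require Import Reals.
From Coquelicot Require Import Coquelicot.
Open Scope R_scope.

Definition japanese (x : R) : R := sqrt (1 + x ^ 2).

(* |s|^p for p > 0.  The case s = 0 is separate because [Rpower 0 p = 1]
   ([ln] is 0 outside the positive reals). *)
Definition abs_pow (s p : R) : R :=
  if Req_EM_T s 0 then 0 else Rpower (Rabs s) p.

Definition Ck (k : nat) (f : R -> R) : Prop :=
  forall j : nat, (j <= k)%nat ->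
  forall x : R, ex_derive_n f j x /\ continuous (Derive_n f j) x.

Definition supp (f : R -> R) : R -> Prop := adherence (fun x => f x <> 0).

Definition C0k (k : nat) (f : R -> R) : Prop := Ck k f /\ compact (supp f).

(* Functions of (x, t) are curried, space variable first, and total; only their
   values on the strip R x [0, T) matter. *)
Definition strip (T : R) (z : R * R) : Prop := 0 <= snd z < T.

Definition continuous_strip (T : R) (u : R -> R -> R) : Prop :=
  forall x t : R, strip T (x, t) ->
  filterlim (fun z : R * R => u (fst z) (snd z))
    (within (strip T) (locally (x, t))) (locally (u x t)).

Definition is_dx (T : R) (u ux : R -> R -> R) : Prop :=
  forall x t : R, strip T (x, t) -> is_derive (fun y => u y t) x (ux x t).

(* The derivative is taken within [0, T), hence from the right at t = 0. *)
Definition is_dt (T : R) (u ut : R -> R -> R) : Prop :=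
  forall x t : R, strip T (x, t) ->
  filterlim (fun s => (u x s - u x t) / (s - t))
    (within (fun s => 0 <= s < T) (locally' t)) (locally (ut x t)).

Fixpoint Ck_strip (k : nat) (T : R) (u : R -> R -> R) : Prop :=
  continuous_strip T u /\
  match k with
  | O => True
  | S k' => exists ux ut : R -> R -> R,
      is_dx T u ux /\ is_dt T u ut /\ Ck_strip k' T ux /\ Ck_strip k' T ut
  end.

Definition classical_solution
    (p a eps : R) (f g : R -> R) (T : R) (u : R -> R -> R) : Prop :=
  Ck_strip 2 T u /\
  exists ux ut uxx utt : R -> R -> R,
    is_dx T u ux /\ is_dt T u ut /\ is_dx T ux uxx /\ is_dt T ut utt /\
    (forall x t : R, 0 < t < T ->
       utt x t - uxx x t = abs_pow (ux x t) p / Rpower (japanese x) a) /\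
    (forall x : R, u x 0 = eps * f x) /\
    (forall x : R, ut x 0 = eps * g x).

Definition lifespan_bound (p a C eps : R) : Rbar :=
  if Rlt_dec a 1 then Finite (C * Rpower eps (- (p - 1) / (1 - a)))
  else if Req_EM_T a 1 then Finite (exp (C * Rpower eps (- (p - 1))))
  else p_infty.

(* Main.v *)
Require Import Defs.
From Stdlib Require Import Reals Lra Lia.
From Coquelicot Require Import Coquelicot.
Open Scope R_scope.

(** The nonlinearity contains only the space derivative [v = u_x], and
    differentiating d'Alembert's formula with Duhamel's term in [x] gives a
    closed equation for it:
    [v = v0 + 1/2 * int_0^t (N (x + t - s) s - N (x - t + s) s) ds],
    where [v0] comes from the data and [N x t = W x * |v x t|^p] with
    [W x = <x>^(-a)].  Along a characteristic of speed 1 or -1 the weight [W]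
    is integrated over an interval of the [x]-axis, so the time integral costs at
    most the mass [J] of [W], whatever [t] is.  Picard's iteration therefore
    contracts in the sup norm on a ball of radius [rho], of the order of
    [eps], as soon as [J * p * rho ^ (p - 1) <= 1/2].

    By finite speed of propagation only the values of [W] on
    [|x| <= Rad + T] matter, so [W] is multiplied by a C^1 cutoff that is 1
    there and 0 beyond [Rad + T + 1].  The truncated equation is solved on the
    whole plane, for all signs of [t], which removes every boundary question at
    [t = 0]; and its mass is at most a constant times
    [int_0^(Rad + T + 1) (1 + y)^(-a) dy], which is of the order of [T^(1-a)],
    [ln T] or [1] according to the sign of [1 - a].  Solving the smallness
    condition for [T] gives the three lifespan bounds ([lifespan_small]).

    Regularity is the delicate point when [p < 2], because the derivative of
    [|s|^p] is then not Lipschitz and the iteration does not contract in C^1.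
    The derivatives [w_n] of the iterates [v_n] still satisfy a linear
    recursion, contracting in [w_n], whose coefficients converge uniformly since
    [v_n] does and since the derivative of [|s|^p] is uniformly continuous on
    bounded sets.  Hence the oscillation of the tails of [w_n] is eventually
    multiplied by a factor below 1 and [w_n] converges uniformly
    ([picard_fixed_point]).  So [v] is C^1; d'Alembert's formula then defines
    [u_t], whose [x]-derivative is [v_t], and [u] is obtained by integrating
    [u_t] in time ([wave_equation_solution]). *)

Set Bullet Behavior "Strict Subproofs".

(** * Continuous functions of two variables *)

Definition cont2 (f : R -> R -> R) : Prop :=
  forall x y : R, continuity_2d_pt f x y.

Lemma cont2_ext (f g : R -> R -> R) :
  (forall x y, f x y = g x y) -> cont2 f -> cont2 g.
Proof.
  intros E Hf x y. exact (continuity_2d_pt_ext f g x y E (Hf x y)).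
Qed.

Lemma cont2_const (c : R) : cont2 (fun _ _ => c).
Proof. intros x y. apply continuity_2d_pt_const. Qed.

Lemma cont2_fst : cont2 (fun x _ => x).
Proof. intros x y. apply continuity_2d_pt_id1. Qed.

Lemma cont2_snd : cont2 (fun _ y => y).
Proof. intros x y. apply continuity_2d_pt_id2. Qed.

Lemma cont2_plus (f g : R -> R -> R) :
  cont2 f -> cont2 g -> cont2 (fun x y => f x y + g x y).
Proof. intros Hf Hg x y. now apply continuity_2d_pt_plus. Qed.

Lemma cont2_minus (f g : R -> R -> R) :
  cont2 f -> cont2 g -> cont2 (fun x y => f x y - g x y).
Proof. intros Hf Hg x y. now apply continuity_2d_pt_minus. Qed.

Lemma cont2_mult (f g : R -> R -> R) :
  cont2 f -> cont2 g -> cont2 (fun x y => f x y * g x y).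
Proof. intros Hf Hg x y. now apply continuity_2d_pt_mult. Qed.

Lemma cont2_comp1 (h : R -> R) (f : R -> R -> R) :
  (forall s, continuous h s) -> cont2 f -> cont2 (fun x y => h (f x y)).
Proof.
  intros Hh Hf x y. apply continuity_1d_2d_pt_comp; [|apply Hf].
  apply continuity_pt_filterlim, Hh.
Qed.

Lemma cont2_comp2 (f g h : R -> R -> R) :
  cont2 f -> cont2 g -> cont2 h -> cont2 (fun x y => f (g x y) (h x y)).
Proof.
  intros Hf Hg Hh x y eps.
  destruct (Hf (g x y) (h x y) eps) as [d Hd].
  destruct (Hg x y d) as [d1 H1], (Hh x y d) as [d2 H2].
  assert (Hm : 0 < Rmin d1 d2) by (apply Rmin_pos; apply cond_pos).
  exists (mkposreal _ Hm). intros u v Hu Hv. simpl in Hu, Hv.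
  pose proof (Rmin_l d1 d2). pose proof (Rmin_r d1 d2).
  apply Hd; [apply H1 | apply H2]; lra.
Qed.

Lemma cont2_curve (f : R -> R -> R) (g h : R -> R) (s : R) :
  cont2 f -> continuous g s -> continuous h s ->
  continuous (fun r => f (g r) (h r)) s.
Proof.
  intros Hf Hg Hh.
  apply (continuous_comp_2 g h f s Hg Hh).
  apply continuity_2d_pt_filterlim, Hf.
Qed.

Lemma cont2_section (f : R -> R -> R) (x : R) :
  cont2 f -> forall s, continuous (f x) s.
Proof.
  intros Hf s. apply (cont2_curve f (fun _ => x) (fun r => r)); auto.
  apply continuous_const. apply continuous_id.
Qed.

Lemma is_derive_continuous (f : R -> R) (x l : R) :
  is_derive f x l -> continuous f x.
Proof. intros H. apply (ex_derive_continuous f). now exists l. Qed.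

Lemma cont_ex_RInt (f : R -> R) (a b : R) :
  (forall s, continuous f s) -> ex_RInt f a b.
Proof. intros Hf. apply (@ex_RInt_continuous R_CompleteNormedModule). auto. Qed.

Lemma abs_RInt_le_abs (f g : R -> R) (a b : R) :
  (forall s, continuous f s) -> (forall s, continuous g s) ->
  (forall s, Rmin a b <= s <= Rmax a b -> Rabs (f s) <= g s) ->
  Rabs (RInt f a b) <= Rabs (RInt g a b).
Proof.
  intros Hf Hg H.
  assert (Le : forall a b, a <= b ->
    (forall s, a <= s <= b -> Rabs (f s) <= g s) ->
    Rabs (RInt f a b) <= Rabs (RInt g a b)).
  { clear a b H. intros a b Hab H.
    apply Rle_trans with (RInt g a b); [|apply Rle_abs].
    apply Rle_trans with (RInt (fun s => Rabs (f s)) a b).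
    - apply abs_RInt_le; auto using cont_ex_RInt.
    - apply RInt_le; auto using cont_ex_RInt.
      + apply cont_ex_RInt. intros s. apply (continuous_comp f Rabs); auto.
        apply continuous_Rabs.
      + intros s Hs. apply H. lra. }
  destruct (Rle_dec a b) as [Hab|Hab].
  - apply Le; auto. rewrite Rmin_left, Rmax_right in H by lra. auto.
  - assert (Hf' := cont_ex_RInt f b a Hf). assert (Hg' := cont_ex_RInt g b a Hg).
    rewrite <- (opp_RInt_swap f), <- (opp_RInt_swap g); auto.
    unfold opp; simpl. rewrite !Rabs_Ropp. apply Le; [lra|].
    rewrite Rmin_right, Rmax_left in H by lra. auto.
Qed.

Lemma abs_RInt_le_length (f : R -> R) (M a b : R) :
  (forall s, continuous f s) ->
  (forall s, Rmin a b <= s <= Rmax a b -> Rabs (f s) <= M) ->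
  Rabs (RInt f a b) <= M * Rabs (b - a).
Proof.
  intros Hf H.
  eapply Rle_trans.
  { apply (abs_RInt_le_abs f (fun _ => M)); auto.
    intros s. apply continuous_const. }
  rewrite RInt_const. unfold scal; simpl; unfold mult; simpl.
  rewrite Rabs_mult, Rmult_comm.
  apply Rmult_le_compat_r; [apply Rabs_pos|].
  rewrite Rabs_right; [lra|].
  assert (A := Rabs_pos (f a)).
  assert (B : Rabs (f a) <= M).
  { apply H. pose proof (Rmin_l a b). pose proof (Rmax_l a b). lra. }
  lra.
Qed.

Lemma RInt_plus_cont (f g : R -> R) (a b : R) :
  (forall s, continuous f s) -> (forall s, continuous g s) ->
  RInt (fun s => f s + g s) a b = RInt f a b + RInt g a b.
Proof. intros. apply (RInt_plus f g); now apply cont_ex_RInt. Qed.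

Lemma RInt_minus_cont (f g : R -> R) (a b : R) :
  (forall s, continuous f s) -> (forall s, continuous g s) ->
  RInt (fun s => f s - g s) a b = RInt f a b - RInt g a b.
Proof. intros. apply (RInt_minus f g); now apply cont_ex_RInt. Qed.

Lemma RInt_scal_cont (f : R -> R) (c a b : R) :
  (forall s, continuous f s) ->
  RInt (fun s => c * f s) a b = c * RInt f a b.
Proof. intros. apply (RInt_scal f); now apply cont_ex_RInt. Qed.

(** Changing [x] costs little because [k] is uniformly continuous on a compact
    neighbourhood of [{x} x [0, t]]; changing the end point costs little because
    a primitive is continuous. *)
Lemma cont2_RInt (k : R -> R -> R) :
  cont2 k -> cont2 (fun x t => RInt (k x) 0 t).
Proof.
  intros Hk x t eps.
  set (A := Rmin 0 t - 1). set (B := Rmax 0 t + 1).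
  pose proof (Rmin_l 0 t). pose proof (Rmin_r 0 t).
  pose proof (Rmax_l 0 t). pose proof (Rmax_r 0 t).
  assert (HAB : A <= B) by (unfold A, B; lra).
  assert (He : 0 < eps / (2 * (Rabs t + 2))).
  { pose proof (Rabs_pos t). pose proof (cond_pos eps).
    apply Rdiv_lt_0_compat; lra. }
  destruct (uniform_continuity_2d_1d' k A B x (fun s _ => Hk x s)
    (mkposreal _ He)) as [d Hd].
  assert (C : continuous (fun r => RInt (k x) 0 r) t).
  { apply (continuous_RInt_1 (k x) 0 t (fun r => RInt (k x) 0 r)).
    exists (mkposreal 1 Rlt_0_1). intros z _.
    apply (@RInt_correct R_CompleteNormedModule).
    apply cont_ex_RInt, cont2_section, Hk. }
  destruct (proj1 (filterlim_locally _ _) C (pos_div_2 eps)) as [d2 Hd2].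
  assert (Hm : 0 < Rmin 1 (Rmin d d2)).
  { repeat apply Rmin_pos; try apply cond_pos. lra. }
  exists (mkposreal _ Hm). intros u v Hu Hv. simpl in Hu, Hv.
  pose proof (Rmin_l 1 (Rmin d d2)). pose proof (Rmin_r 1 (Rmin d d2)).
  pose proof (Rmin_l d d2). pose proof (Rmin_r d d2).
  assert (E2 : Rabs (RInt (k x) 0 v - RInt (k x) 0 t) < eps / 2).
  { apply (Hd2 v). change (Rabs (v - t) < d2). lra. }
  assert (Ev : v - t < 1 /\ - 1 < v - t) by (apply Rabs_def2; lra).
  assert (E1 : Rabs (RInt (k u) 0 v - RInt (k x) 0 v)
    <= eps / (2 * (Rabs t + 2)) * Rabs (v - 0)).
  { rewrite <- RInt_minus_cont by (apply cont2_section, Hk).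
    apply abs_RInt_le_length.
    - intros s. apply (continuous_minus (k u) (k x)); apply cont2_section, Hk.
    - intros s Hs. apply Rlt_le.
      assert (As : A <= s <= B).
      { unfold A, B. unfold Rmin, Rmax in *.
        destruct (Rle_dec 0 t), (Rle_dec 0 v); lra. }
      apply Rabs_def2 in Hu. pose proof (cond_pos d).
      apply (Hd s x s u); auto; try lra.
      rewrite Rminus_diag, Rabs_R0. lra. }
  assert (E3 : Rabs (v - 0) < Rabs t + 2).
  { replace (v - 0) with (t + (v - t)) by ring.
    pose proof (Rabs_triang t (v - t)). lra. }
  assert (E4 : eps / (2 * (Rabs t + 2)) * Rabs (v - 0) < eps / 2).
  { replace (eps / 2) with (eps / (2 * (Rabs t + 2)) * (Rabs t + 2)).
    - apply Rmult_lt_compat_l; auto.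
    - field. pose proof (Rabs_pos t). lra. }
  replace (RInt (k u) 0 v - RInt (k x) 0 t) with
    ((RInt (k u) 0 v - RInt (k x) 0 v) + (RInt (k x) 0 v - RInt (k x) 0 t)) by ring.
  eapply Rle_lt_trans; [apply Rabs_triang|]. lra.
Qed.

(** * Integration along characteristics *)

(** The integral of [n] along the characteristic of speed [- c] that reaches
    [(x, t)].  For negative [t] it runs backwards in time. *)
Definition duhamel (c : R) (n : R -> R -> R) (x t : R) : R :=
  RInt (fun s => n (x + c * (t - s)) s) 0 t.

Lemma cont2_char (c : R) (n : R -> R -> R) (t : R) :
  cont2 n -> cont2 (fun x s => n (x + c * (t - s)) s).
Proof.
  intros Hn. apply cont2_comp2; auto using cont2_snd.
  auto using cont2_plus, cont2_mult, cont2_minus, cont2_const, cont2_fst, cont2_snd.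
Qed.

Lemma char_continuous (c : R) (n : R -> R -> R) (x t : R) :
  cont2 n -> forall s, continuous (fun s => n (x + c * (t - s)) s) s.
Proof. intros Hn. exact (cont2_section _ x (cont2_char c n t Hn)). Qed.

(** In the variables [x + c t] and [t] the integrand does not depend on the end
    point of the integral, which reduces the claim to [cont2_RInt]. *)
Lemma cont2_duhamel (c : R) (n : R -> R -> R) :
  cont2 n -> cont2 (duhamel c n).
Proof.
  intros Hn.
  apply cont2_ext with
    (fun x t => RInt ((fun y s => n (y - c * s) s) (x + c * t)) 0 t).
  { intros x t. apply RInt_ext. intros s _. f_equal. ring. }
  apply (cont2_comp2 (fun y t => RInt ((fun y s => n (y - c * s) s) y) 0 t)
    (fun x t => x + c * t) (fun _ t => t)).
  - apply cont2_RInt, cont2_comp2; auto using cont2_snd.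
    auto using cont2_plus, cont2_mult, cont2_minus, cont2_const, cont2_fst, cont2_snd.
  - auto using cont2_plus, cont2_mult, cont2_minus, cont2_const, cont2_fst, cont2_snd.
  - apply cont2_snd.
Qed.

Lemma is_derive_duhamel_x (c : R) (n nx : R -> R -> R) (x t : R) :
  cont2 n -> cont2 nx ->
  (forall x t, is_derive (fun y => n y t) x (nx x t)) ->
  is_derive (fun y => duhamel c n y t) x (duhamel c nx x t).
Proof.
  intros Hn Hnx Hd.
  assert (Hs : forall y s, is_derive (fun y => n (y + c * (t - s)) s) y
    (nx (y + c * (t - s)) s)).
  { intros y s.
    evar_last. apply (is_derive_comp (fun z => n z s) (fun y => y + c * (t - s))).
    apply Hd. auto_derive; auto. unfold scal; simpl; unfold mult; simpl; ring. }
  unfold duhamel.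
  rewrite (RInt_ext (fun s => nx (x + c * (t - s)) s)
    (fun s => Derive (fun y => n (y + c * (t - s)) s) x)).
  2:{ intros s _. symmetry. apply is_derive_unique, Hs. }
  apply (is_derive_RInt_param (fun y s => n (y + c * (t - s)) s) 0 t x).
  - apply filter_forall. intros y s _. eexists. apply Hs.
  - intros s _. eapply continuity_2d_pt_ext.
    { intros y r. symmetry. apply is_derive_unique, Hs. }
    apply cont2_char; auto.
  - apply filter_forall. intros y. apply cont_ex_RInt, char_continuous, Hn.
Qed.

(** [n x t] comes from the moving end point; otherwise the integrand depends on [t]
    through [x + c (t - s)] alone, hence the factor [c]. *)
Lemma is_derive_duhamel_t (c : R) (n nx : R -> R -> R) (x t : R) :
  cont2 n -> cont2 nx ->
  (forall x t, is_derive (fun y => n y t) x (nx x t)) ->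
  is_derive (fun r => duhamel c n x r) t (n x t + c * duhamel c nx x t).
Proof.
  intros Hn Hnx Hd.
  assert (Hs : forall r s, is_derive (fun r => n (x + c * (r - s)) s) r
    (c * nx (x + c * (r - s)) s)).
  { intros r s.
    evar_last. apply (is_derive_comp (fun z => n z s) (fun r => x + c * (r - s))).
    apply Hd. auto_derive; auto. unfold scal; simpl; unfold mult; simpl; ring. }
  assert (Hc : cont2 (fun r s => Derive (fun r => n (x + c * (r - s)) s) r)).
  { eapply cont2_ext.
    { intros r s. symmetry. apply is_derive_unique, Hs. }
    apply cont2_mult, cont2_comp2;
    auto using cont2_plus, cont2_mult, cont2_minus, cont2_const, cont2_fst, cont2_snd. }
  evar_last.
  - apply (is_derive_RInt_param_bound_comp (fun r s => n (x + c * (r - s)) s)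
      (fun _ => 0) (fun r => r) t 0 1).
    + apply filter_forall. intros y. apply cont_ex_RInt, char_continuous, Hn.
    + exists (mkposreal 1 Rlt_0_1). apply filter_forall. intros y.
      apply cont_ex_RInt, char_continuous, Hn.
    + exists (mkposreal 1 Rlt_0_1). apply filter_forall. intros y.
      apply cont_ex_RInt, char_continuous, Hn.
    + auto_derive; auto.
    + auto_derive; auto.
    + exists (mkposreal 1 Rlt_0_1). apply filter_forall. intros y s _.
      eexists; apply Hs.
    + intros s _. apply Hc.
    + exists (mkposreal 1 Rlt_0_1). intros; apply Hc.
    + exists (mkposreal 1 Rlt_0_1). intros; apply Hc.
    + apply continuity_pt_filterlim, (char_continuous c n x t Hn).
    + apply continuity_pt_filterlim, (char_continuous c n x t Hn).
  - rewrite (RInt_ext _ (fun s => c * (nx (x + c * (t - s)) s))).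
    2:{ intros s _. apply is_derive_unique, Hs. }
    rewrite (RInt_scal_cont (fun s => nx (x + c * (t - s)) s))
      by apply char_continuous, Hnx.
    unfold duhamel.
    replace (x + c * (t - t)) with x by ring. ring.
Qed.

(** Signed and unordered end points make this symmetric in the sign of [t] and in
    the direction of propagation. *)
Definition mass_le (W : R -> R) (J : R) : Prop :=
  forall x y : R, Rabs (RInt W x y) <= J.

(** Since [c] is 1 or -1, time along a characteristic is distance in space, so the
    bound is uniform in [t]. *)
Lemma duhamel_bound (c : R) (n : R -> R -> R) (W : R -> R) (J K : R) :
  c * c = 1 -> cont2 n -> (forall x, continuous W x) -> mass_le W J -> 0 <= K ->
  (forall x t, Rabs (n x t) <= W x * K) ->
  forall x t, Rabs (duhamel c n x t) <= J * K.
Proof.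
  intros Hc Hn HW HJ HK H x t.
  assert (HWs : forall s, continuous (fun s => W (- c * s + (x + c * t))) s).
  { intros s. apply (continuous_comp (fun s => - c * s + (x + c * t)) W); auto.
    apply (is_derive_continuous (fun s : R => - c * s + (x + c * t)) s (- c)).
    auto_derive; auto; ring. }
  assert (E : Rabs (RInt (fun s => W (- c * s + (x + c * t))) 0 t) <= J).
  { assert (E := RInt_comp_lin W (- c) (x + c * t) 0 t (cont_ex_RInt W _ _ HW)).
    change (RInt (fun s => - c * W (- c * s + (x + c * t))) 0 t =
      RInt W (- c * 0 + (x + c * t)) (- c * t + (x + c * t))) in E.
    rewrite (RInt_scal_cont (fun s => W (- c * s + (x + c * t)))) in E by apply HWs.
    eapply Rle_trans; [|apply HJ]. rewrite <- E.
    rewrite Rabs_mult.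
    replace (Rabs (- c)) with 1; [rewrite Rmult_1_l; apply Rle_refl|].
    rewrite Rabs_Ropp. assert (A := Rsqr_abs c). unfold Rsqr in A.
    pose proof (Rabs_pos c). nra. }
  eapply Rle_trans.
  - apply (abs_RInt_le_abs _ (fun s => K * W (- c * s + (x + c * t)))).
    + apply char_continuous, Hn.
    + intros s. apply (continuous_scal_r K (fun s => W (- c * s + (x + c * t)))), HWs.
    + intros s _. rewrite (Rmult_comm K).
      replace (- c * s + (x + c * t)) with (x + c * (t - s)) by ring.
      apply H.
  - rewrite (RInt_scal_cont (fun s => W (- c * s + (x + c * t)))) by apply HWs.
    rewrite Rabs_mult, (Rabs_right K) by lra. rewrite Rmult_comm.
    apply Rmult_le_compat_r; auto.
Qed.

Lemma duhamel_minus (c : R) (n1 n2 : R -> R -> R) (x t : R) :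
  cont2 n1 -> cont2 n2 ->
  duhamel c (fun x t => n1 x t - n2 x t) x t = duhamel c n1 x t - duhamel c n2 x t.
Proof.
  intros H1 H2. unfold duhamel.
  apply (RInt_minus_cont (fun s => n1 (x + c * (t - s)) s)
    (fun s => n2 (x + c * (t - s)) s)); apply char_continuous; auto.
Qed.

(** Support in the domain of influence of the interval [|x| <= r]. *)
Definition cone_supp (r : R) (n : R -> R -> R) : Prop :=
  forall x t, r + Rabs t < Rabs x -> n x t = 0.

(** A point outside the cone stays outside it along both backward
    characteristics. *)
Lemma duhamel_cone_supp (c r : R) (n : R -> R -> R) :
  c * c = 1 -> cone_supp r n -> cone_supp r (duhamel c n).
Proof.
  intros Hc Hn x t Hx. unfold duhamel.
  rewrite (RInt_ext _ (fun _ => 0)).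
  { rewrite RInt_const. unfold scal; simpl; unfold mult; simpl; ring. }
  intros s Hs. apply Hn.
  assert (Ac : Rabs c = 1).
  { assert (A := Rsqr_abs c). unfold Rsqr in A. pose proof (Rabs_pos c). nra. }
  assert (T : Rabs x <= Rabs (x + c * (t - s)) + Rabs (t - s)).
  { replace (Rabs (t - s)) with (Rabs (- (c * (t - s)))).
    2:{ rewrite Rabs_Ropp, Rabs_mult, Ac. ring. }
    eapply Rle_trans; [|apply Rabs_triang]. right; f_equal; ring. }
  assert (Rabs t = Rabs s + Rabs (t - s)).
  { unfold Rmin, Rmax in Hs. destruct (Rle_dec 0 t).
    - rewrite !Rabs_right; lra.
    - rewrite !Rabs_left; lra. }
  lra.
Qed.

(** * Uniform limits *)

Definition osc_le (F : nat -> R -> R -> R) (N : nat) (e : R) : Prop :=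
  forall m k x t, (N <= m)%nat -> (N <= k)%nat -> Rabs (F m x t - F k x t) <= e.

Definition unif_lim (F : nat -> R -> R -> R) (f : R -> R -> R) : Prop :=
  forall e, 0 < e -> exists N, forall n x t, (N <= n)%nat -> Rabs (F n x t - f x t) <= e.

(** Replaces a geometric rate of convergence, which the derivatives of the
    iterates need not have: it is enough that each bound on the oscillation of the
    tails can be improved by a fixed factor. *)
Lemma osc_geometric_cauchy (F : nat -> R -> R -> R) (B : R) :
  osc_le F 0 B ->
  (forall e N, 0 < e -> osc_le F N e -> exists N', osc_le F N' (3 / 4 * e)) ->
  forall e, 0 < e -> exists N, osc_le F N e.
Proof.
  intros H0 H e He.
  set (B' := Rmax 1 B).
  assert (HB : 0 < B') by (unfold B'; pose proof (Rmax_l 1 B); lra).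
  assert (P : forall j, exists N, osc_le F N ((3 / 4) ^ j * B')).
  { induction j as [|j [N IH]].
    - exists 0%nat. intros m k x t Hm Hk. simpl. rewrite Rmult_1_l.
      eapply Rle_trans; [apply H0; auto | apply Rmax_r].
    - assert (Hp : 0 < (3 / 4) ^ j * B')
        by (apply Rmult_lt_0_compat; auto; apply pow_lt; lra).
      destruct (H _ N Hp IH) as [N' HN']. exists N'. simpl.
      rewrite Rmult_assoc. exact HN'. }
  destruct (pow_lt_1_zero (3 / 4)) with (y := e / B') as [j Hj].
  { rewrite Rabs_right; lra. }
  { apply Rdiv_lt_0_compat; auto. }
  destruct (P j) as [N HN]. exists N. intros m k x t Hm Hk.
  eapply Rle_trans; [apply HN; auto|].
  specialize (Hj j (le_n _)). rewrite Rabs_right in Hj.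
  2:{ apply Rle_ge, pow_le; lra. }
  apply Rlt_le. replace e with (e / B' * B') by (field; lra).
  apply Rmult_lt_compat_r; auto.
Qed.

Lemma cauchy_unif_lim (F : nat -> R -> R -> R) :
  (forall e, 0 < e -> exists N, osc_le F N e) -> exists f, unif_lim F f.
Proof.
  intros H. exists (fun x t => real (Lim_seq (fun n => F n x t))).
  intros e He. destruct (H (e / 2)) as [N HN]; [lra|]. exists N.
  intros n x t Hn.
  assert (C : ex_finite_lim_seq (fun n => F n x t)).
  { apply ex_lim_seq_cauchy_corr. intros d.
    destruct (H (d / 2)) as [M HM]. { pose proof (cond_pos d). lra. }
    exists M. intros m k Hm Hk. pose proof (HM m k x t Hm Hk). pose proof (cond_pos d).
    lra. }
  apply Lim_seq_correct', is_lim_seq_spec in C.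
  assert (He2 : 0 < e / 2) by lra.
  destruct (C (mkposreal _ He2)) as [M HM]. simpl in HM.
  specialize (HM (max N M) (Nat.le_max_r _ _)).
  pose proof (HN n (max N M) x t Hn (Nat.le_max_l _ _)) as H1.
  replace (F n x t - real (Lim_seq (fun n => F n x t))) with
    ((F n x t - F (max N M) x t) +
     (F (max N M) x t - real (Lim_seq (fun n => F n x t)))) by ring.
  eapply Rle_trans; [apply Rabs_triang|]. lra.
Qed.

Lemma unif_lim_cont2 (F : nat -> R -> R -> R) (f : R -> R -> R) :
  unif_lim F f -> (forall n, cont2 (F n)) -> cont2 f.
Proof.
  intros HF Hc x t eps. pose proof (cond_pos eps).
  destruct (HF (eps / 4)) as [N HN]; [lra|].
  destruct (Hc N x t (pos_div_2 eps)) as [d Hd]. exists d. intros u v Hu Hv.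
  specialize (Hd u v Hu Hv). simpl in Hd.
  pose proof (HN N u v (le_n _)) as H1. pose proof (HN N x t (le_n _)) as H2.
  apply Rabs_def2 in Hd. apply Rabs_le_between in H1, H2.
  apply Rabs_def1; lra.
Qed.

Lemma unif_lim_bound (F : nat -> R -> R -> R) (f : R -> R -> R) (B : R) :
  unif_lim F f -> (forall n x t, Rabs (F n x t) <= B) ->
  forall x t, Rabs (f x t) <= B.
Proof.
  intros HF HB x t. apply le_epsilon. intros e He.
  destruct (HF e He) as [N HN]. specialize (HN N x t (le_n _)).
  specialize (HB N x t). apply Rabs_le_between in HN, HB. apply Rabs_le; lra.
Qed.

(** The fundamental theorem of calculus passes to the uniform limit. *)
Lemma unif_lim_is_derive (F G : nat -> R -> R -> R) (f g : R -> R -> R) :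
  unif_lim F f -> unif_lim G g -> (forall n, cont2 (G n)) ->
  (forall n x t, is_derive (fun y => F n y t) x (G n x t)) ->
  forall x t, is_derive (fun y => f y t) x (g x t).
Proof.
  intros HF HG Hc Hd x t.
  assert (Hg : cont2 g) by exact (unif_lim_cont2 G g HG Hc).
  assert (Cs : forall h, cont2 h -> forall s, continuous (fun y => h y t) s).
  { intros h Hh s. apply (cont2_curve h (fun r => r) (fun _ => t)); auto.
    apply continuous_id. apply continuous_const. }
  assert (E : forall y, f 0 t + RInt (fun z => g z t) 0 y = f y t).
  { intros y. apply Rminus_diag_uniq. apply cond_eq. intros e He.
    (* Twice [d] for the values of [F], [d * |y|] for the integral, and one
       spare [d] to make the inequality strict. *)
    set (d := e / (3 + Rabs y)).
    pose proof (Rabs_pos y).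
    assert (Hd0 : 0 < d) by (apply Rdiv_lt_0_compat; lra).
    assert (De : d * (3 + Rabs y) = e) by (unfold d; field; lra).
    destruct (HF d Hd0) as [N1 H1], (HG d Hd0) as [N2 H2].
    set (n := max N1 N2).
    pose proof (H1 n y t (Nat.le_max_l _ _)) as A1.
    pose proof (H1 n 0 t (Nat.le_max_l _ _)) as A2.
    assert (A3 : Rabs (RInt (fun z => G n z t) 0 y - RInt (fun z => g z t) 0 y)
      <= d * Rabs (y - 0)).
    { rewrite <- RInt_minus_cont by auto.
      apply abs_RInt_le_length.
      - intros s. apply (continuous_minus (fun z => G n z t) (fun z => g z t)); auto.
      - intros s _. apply H2, Nat.le_max_r. }
    assert (A4 : RInt (fun z => G n z t) 0 y = F n y t - F n 0 t).
    { apply is_RInt_unique.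
      apply (is_RInt_derive (fun z => F n z t) (fun z => G n z t)); auto. }
    rewrite A4 in A3. rewrite Rminus_0_r in A3. rewrite Rminus_0_r.
    apply Rabs_le_between in A1, A2, A3.
    apply Rabs_def1; nra. }
  apply (is_derive_ext (fun y => f 0 t + RInt (fun z => g z t) 0 y)); auto.
  evar_last.
  - apply (is_derive_plus (fun _ => f 0 t) (fun y => RInt (fun z => g z t) 0 y)).
    + apply is_derive_const.
    + apply (is_derive_RInt (fun z => g z t) _ 0); auto.
      apply filter_forall. intros y.
      apply (@RInt_correct R_CompleteNormedModule), cont_ex_RInt; auto.
  - apply plus_zero_l.
Qed.

(** * Picard iteration for the space derivative *)

Lemma mass_le_nonneg (W : R -> R) (J : R) : mass_le W J -> 0 <= J.
Proof. intros H. eapply Rle_trans; [apply Rabs_pos | apply (H 0 0)]. Qed.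

Lemma mass_le_comb (W1 W2 : R -> R) (J1 J2 c1 c2 : R) :
  (forall x, continuous W1 x) -> (forall x, continuous W2 x) ->
  0 <= c1 -> 0 <= c2 -> mass_le W1 J1 -> mass_le W2 J2 ->
  mass_le (fun x => c1 * W1 x + c2 * W2 x) (c1 * J1 + c2 * J2).
Proof.
  intros C1 C2 H1 H2 M1 M2 x y.
  assert (C : forall (c : R) (W : R -> R), (forall x, continuous W x) ->
    forall x, continuous (fun x => c * W x) x).
  { intros c W HW z. apply (continuous_scal_r c W), HW. }
  rewrite (RInt_plus_cont (fun x => c1 * W1 x) (fun x => c2 * W2 x)) by auto.
  rewrite !RInt_scal_cont by auto.
  eapply Rle_trans; [apply Rabs_triang|].
  rewrite !Rabs_mult, (Rabs_right c1), (Rabs_right c2) by lra.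
  apply Rplus_le_compat; apply Rmult_le_compat_l; auto.
Qed.

(** The contribution to [u_x] of the source [n] in Duhamel's formula for
    [u_tt - u_xx = n]. *)
Definition wave (n : R -> R -> R) (x t : R) : R :=
  / 2 * (duhamel 1 n x t - duhamel (-1) n x t).

Lemma cont2_wave (n : R -> R -> R) : cont2 n -> cont2 (wave n).
Proof.
  intros Hn.
  apply cont2_mult; auto using cont2_minus, cont2_duhamel, cont2_const.
Qed.

Lemma is_derive_wave_x (n nx : R -> R -> R) (x t : R) :
  cont2 n -> cont2 nx ->
  (forall x t, is_derive (fun y => n y t) x (nx x t)) ->
  is_derive (fun y => wave n y t) x (wave nx x t).
Proof.
  intros Hn Hnx Hd. unfold wave.
  apply (is_derive_scal (fun y => duhamel 1 n y t - duhamel (-1) n y t)).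
  apply (is_derive_minus (fun y => duhamel 1 n y t) (fun y => duhamel (-1) n y t));
    apply is_derive_duhamel_x; auto.
Qed.

(** Each of the two characteristics contributes half of the mass. *)
Lemma wave_bound (n : R -> R -> R) (W : R -> R) (J c : R) :
  cont2 n -> (forall x, continuous W x) -> mass_le W J -> 0 <= c ->
  (forall x t, Rabs (n x t) <= W x * c) ->
  forall x t, Rabs (wave n x t) <= J * c.
Proof.
  intros Hn HW HJ Hc H x t.
  pose proof (duhamel_bound 1 n W J c ltac:(ring) Hn HW HJ Hc H x t) as B1.
  pose proof (duhamel_bound (-1) n W J c ltac:(ring) Hn HW HJ Hc H x t) as B2.
  unfold wave. apply Rabs_le_between in B1, B2. apply Rabs_le; lra.
Qed.

Lemma wave_bound_two (n : R -> R -> R) (W1 W2 : R -> R) (J1 J2 c1 c2 : R) :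
  cont2 n -> (forall x, continuous W1 x) -> (forall x, continuous W2 x) ->
  mass_le W1 J1 -> mass_le W2 J2 -> 0 <= c1 -> 0 <= c2 ->
  (forall x t, Rabs (n x t) <= c1 * W1 x + c2 * W2 x) ->
  forall x t, Rabs (wave n x t) <= c1 * J1 + c2 * J2.
Proof.
  intros Hn C1 C2 M1 M2 H1 H2 H x t.
  rewrite <- (Rmult_1_r (c1 * J1 + c2 * J2)).
  apply (wave_bound n (fun x => c1 * W1 x + c2 * W2 x)); auto.
  - intros y. apply (continuous_plus (fun x => c1 * W1 x) (fun x => c2 * W2 x)).
    + apply (continuous_scal_r c1 W1), C1.
    + apply (continuous_scal_r c2 W2), C2.
  - now apply mass_le_comb.
  - lra.
  - intros; rewrite Rmult_1_r; auto.
Qed.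

Lemma wave_minus (n1 n2 : R -> R -> R) (x t : R) :
  cont2 n1 -> cont2 n2 ->
  wave (fun x t => n1 x t - n2 x t) x t = wave n1 x t - wave n2 x t.
Proof.
  intros H1 H2. unfold wave. rewrite !duhamel_minus by auto. field.
Qed.

Lemma wave_cone_supp (r : R) (n : R -> R -> R) :
  cone_supp r n -> cone_supp r (wave n).
Proof.
  intros Hn x t Hx. unfold wave.
  rewrite !(duhamel_cone_supp _ r n) by (auto; ring). field.
Qed.

Definition source (W phi : R -> R) (v : R -> R -> R) (x t : R) : R :=
  W x * phi (v x t).

Definition source_dx (W W' phi phi' : R -> R) (v w : R -> R -> R) (x t : R) : R :=
  W' x * phi (v x t) + W x * (phi' (v x t) * w x t).

Lemma cont2_source (W phi : R -> R) (v : R -> R -> R) :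
  (forall x, continuous W x) -> (forall s, continuous phi s) -> cont2 v ->
  cont2 (source W phi v).
Proof.
  intros HW Hphi Hv. apply cont2_mult; apply cont2_comp1; auto using cont2_fst.
Qed.

Lemma cont2_source_dx (W W' phi phi' : R -> R) (v w : R -> R -> R) :
  (forall x, continuous W x) -> (forall x, continuous W' x) ->
  (forall s, continuous phi s) -> (forall s, continuous phi' s) ->
  cont2 v -> cont2 w -> cont2 (source_dx W W' phi phi' v w).
Proof.
  intros HW HW' Hphi Hphi' Hv Hw.
  apply cont2_plus; apply cont2_mult; try apply cont2_mult; auto;
    apply cont2_comp1; auto using cont2_fst.
Qed.

Lemma is_derive_source (W W' phi phi' : R -> R) (v w : R -> R -> R) (x t : R) :
  (forall x, is_derive W x (W' x)) -> (forall s, is_derive phi s (phi' s)) ->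
  is_derive (fun y => v y t) x (w x t) ->
  is_derive (fun y => source W phi v y t) x (source_dx W W' phi phi' v w x t).
Proof.
  intros HW Hphi Hd. unfold source, source_dx. evar_last.
  - apply (is_derive_mult W (fun y => phi (v y t))).
    + apply HW.
    + apply (is_derive_comp phi (fun y => v y t)); eauto.
    + intros; apply Rmult_comm.
  - unfold plus, scal, mult; simpl. unfold mult; simpl. ring.
Qed.

(** In this section [v0] plays the role of the space derivative of the free wave
    and [v0x] is the [x]-derivative of [v0]; [W] is an integrable weight and
    [phi] the nonlinearity; [q] is a Lipschitz constant of [phi] on the ball of
    radius [rho].  The inequality [small] makes the iteration map this ball into
    itself and contract. *)
Section Picard.

Variables (v0 v0x : R -> R -> R) (W W' phi phi' : R -> R) (rho m1 J K q r : R).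

Hypothesis v0_cont : cont2 v0.
Hypothesis v0x_cont : cont2 v0x.
Hypothesis v0_derive : forall x t, is_derive (fun y => v0 y t) x (v0x x t).
Hypothesis v0_bound : forall x t, Rabs (v0 x t) <= rho / 2.
Hypothesis v0x_bound : forall x t, Rabs (v0x x t) <= m1.
Hypothesis v0_supp : cone_supp r v0.

Hypothesis W_derive : forall x, is_derive W x (W' x).
Hypothesis W'_cont : forall x, continuous W' x.
Hypothesis W_nonneg : forall x, 0 <= W x.
Hypothesis W_mass : mass_le W J.
Hypothesis W'_mass : mass_le (fun x => Rabs (W' x)) K.

Hypothesis phi_derive : forall s, is_derive phi s (phi' s).
Hypothesis phi'_cont : forall s, continuous phi' s.
Hypothesis phi_0 : phi 0 = 0.
Hypothesis phi'_bound : forall s, Rabs s <= rho -> Rabs (phi' s) <= q.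
Hypothesis small : J * q <= 1 / 2.

Let W_cont (x : R) : continuous W x.
Proof. exact (is_derive_continuous _ _ _ (W_derive x)). Qed.

Let absW'_cont (x : R) : continuous (fun x => Rabs (W' x)) x.
Proof. apply (continuous_comp W' Rabs); auto. apply continuous_Rabs. Qed.

Let phi_cont (x : R) : continuous phi x.
Proof. exact (is_derive_continuous _ _ _ (phi_derive x)). Qed.

Let rho_nonneg : 0 <= rho.
Proof. pose proof (Rabs_pos (v0 0 0)). pose proof (v0_bound 0 0). lra. Qed.

Let q_nonneg : 0 <= q.
Proof.
  eapply Rle_trans; [apply Rabs_pos | apply (phi'_bound 0)].
  rewrite Rabs_R0; auto.
Qed.

Let m1_nonneg : 0 <= m1.
Proof. eapply Rle_trans; [apply Rabs_pos | apply (v0x_bound 0 0)]. Qed.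

Let J_nonneg : 0 <= J := mass_le_nonneg W J W_mass.
Let K_nonneg : 0 <= K := mass_le_nonneg _ K W'_mass.

Let phi_lipschitz (a b : R) :
  Rabs a <= rho -> Rabs b <= rho -> Rabs (phi a - phi b) <= q * Rabs (a - b).
Proof.
  intros Ha Hb.
  destruct (MVT_gen phi b a phi') as [c [Hc E]]; auto.
  { intros x _. apply continuity_pt_filterlim, phi_cont. }
  rewrite E, Rabs_mult. apply Rmult_le_compat_r; [apply Rabs_pos|].
  apply phi'_bound. apply Rabs_le_between in Ha, Hb. apply Rabs_le.
  unfold Rmin, Rmax in Hc. destruct (Rle_dec b a); lra.
Qed.

Let phi_bound (a : R) : Rabs a <= rho -> Rabs (phi a) <= q * rho.
Proof.
  intros Ha. replace (phi a) with (phi a - phi 0) by (rewrite phi_0; ring).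
  eapply Rle_trans; [apply phi_lipschitz; auto; rewrite Rabs_R0; auto|].
  apply Rmult_le_compat_l; auto. now rewrite Rminus_0_r.
Qed.

(** The second component follows the derivative of the first in [x]. *)
Fixpoint picard (n : nat) : (R -> R -> R) * (R -> R -> R) :=
  match n with
  | O => (fun _ _ => 0, fun _ _ => 0)
  | S n =>
    let (v, w) := picard n in
    (fun x t => v0 x t + wave (source W phi v) x t,
     fun x t => v0x x t + wave (source_dx W W' phi phi' v w) x t)
  end.

(** The fixed point of [B = m1 + K q rho + B / 2]: the recursion for the
    derivative has the inhomogeneous part [m1 + K q rho] and contracts by 1/2. *)
Let Bw : R := 2 * (m1 + K * (q * rho)).

Let Bw_nonneg : 0 <= Bw.
Proof.
  unfold Bw. assert (0 <= K * (q * rho)) by (repeat apply Rmult_le_pos; auto). lra.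
Qed.

Let src_cont (v : R -> R -> R) : cont2 v -> cont2 (source W phi v) :=
  cont2_source W phi v W_cont phi_cont.

Let src_dx_cont (v w : R -> R -> R) :
  cont2 v -> cont2 w -> cont2 (source_dx W W' phi phi' v w) :=
  cont2_source_dx W W' phi phi' v w W_cont W'_cont phi_cont phi'_cont.

Let picard_inv (v w : R -> R -> R) : Prop :=
  cont2 v /\ cont2 w /\ (forall x t, is_derive (fun y => v y t) x (w x t)) /\
  (forall x t, Rabs (v x t) <= rho) /\ (forall x t, Rabs (w x t) <= Bw) /\
  cone_supp r v.

Let inv_step (v w : R -> R -> R) : picard_inv v w ->
  picard_inv (fun x t => v0 x t + wave (source W phi v) x t)
      (fun x t => v0x x t + wave (source_dx W W' phi phi' v w) x t).
Proof.
  intros (Cv & Cw & Dv & Bv & Bw' & Sv).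
  refine (conj _ (conj _ (conj _ (conj _ (conj _ _))))).
  - auto using cont2_plus, cont2_wave.
  - auto using cont2_plus, cont2_wave.
  - intros x t.
    apply (is_derive_plus (fun y => v0 y t)
      (fun y => wave (source W phi v) y t)); auto.
    apply is_derive_wave_x; auto.
    intros; apply is_derive_source; auto.
  - intros x t. eapply Rle_trans; [apply Rabs_triang|].
    assert (E : Rabs (wave (source W phi v) x t) <= J * (q * rho)).
    { apply (wave_bound _ W); auto; [nra|].
      intros y s. unfold source.
      rewrite Rabs_mult, (Rabs_right (W y)) by (apply Rle_ge; auto).
      apply Rmult_le_compat_l; auto. }
    pose proof (v0_bound x t). nra.
  - intros x t. eapply Rle_trans; [apply Rabs_triang|].
    assert (E : Rabs (wave (source_dx W W' phi phi' v w) x t) <= q * Bw * J + q * rho * K).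
    { apply (wave_bound_two _ W (fun x => Rabs (W' x))); auto; try nra.
      intros y s. unfold source_dx.
      eapply Rle_trans; [apply Rabs_triang|].
      rewrite !Rabs_mult, (Rabs_right (W y)) by (apply Rle_ge; auto).
      rewrite Rplus_comm. apply Rplus_le_compat.
      - rewrite (Rmult_comm (q * Bw)). apply Rmult_le_compat_l; auto.
        apply Rmult_le_compat; auto using Rabs_pos.
      - rewrite (Rmult_comm (q * rho)). apply Rmult_le_compat_l; auto using Rabs_pos. }
    pose proof (v0x_bound x t).
    assert (q * Bw * J <= Bw / 2) by nra.
    assert (Bw / 2 = m1 + K * (q * rho)) by (unfold Bw; field). nra.
  - intros x t Hx. rewrite v0_supp by auto.
    rewrite (wave_cone_supp r (source W phi v)); auto; [ring|].
    intros y s Hy. unfold source. rewrite Sv, phi_0 by auto. ring.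
Qed.

Let V (n : nat) := fst (picard n).
Let Vx (n : nat) := snd (picard n).

Let V_S (n : nat) (x t : R) : V (S n) x t = v0 x t + wave (source W phi (V n)) x t.
Proof. unfold V. simpl. destruct (picard n); reflexivity. Qed.

Let Vx_S (n : nat) (x t : R) :
  Vx (S n) x t = v0x x t + wave (source_dx W W' phi phi' (V n) (Vx n)) x t.
Proof. unfold V, Vx. simpl. destruct (picard n); reflexivity. Qed.

Let inv_picard (n : nat) : picard_inv (V n) (Vx n).
Proof.
  induction n as [|n IH].
  - unfold V, Vx; simpl.
    refine (conj _ (conj _ (conj _ (conj _ (conj _ _))))); try apply cont2_const.
    + intros x t. apply (is_derive_const (V := R_NormedModule) 0).
    + intros; rewrite Rabs_R0; auto.
    + intros; rewrite Rabs_R0; auto.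
    + intros x t _. reflexivity.
  - generalize (inv_step _ _ IH). unfold V, Vx. simpl.
    now destruct (picard n).
Qed.

Let source_contract (v1 v2 : R -> R -> R) (e : R) :
  cont2 v1 -> cont2 v2 ->
  (forall x t, Rabs (v1 x t) <= rho) -> (forall x t, Rabs (v2 x t) <= rho) ->
  0 <= e -> (forall x t, Rabs (v1 x t - v2 x t) <= e) ->
  forall x t, Rabs (wave (source W phi v1) x t - wave (source W phi v2) x t) <= e / 2.
Proof.
  intros C1 C2 B1 B2 He H x t.
  rewrite <- wave_minus by auto.
  apply Rle_trans with (J * (q * e)); [|nra].
  apply (wave_bound _ W); auto using cont2_minus; [nra|].
  intros y s. unfold source. rewrite <- Rmult_minus_distr_l.
  rewrite Rabs_mult, (Rabs_right (W y)) by (apply Rle_ge; auto).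
  apply Rmult_le_compat_l; auto.
  eapply Rle_trans; [apply phi_lipschitz; auto|].
  apply Rmult_le_compat_l; auto.
Qed.

Let V_cauchy (e : R) : 0 < e -> exists N, osc_le V N e.
Proof.
  apply (osc_geometric_cauchy V (2 * rho)).
  - intros m k x t _ _.
    destruct (inv_picard m) as (_ & _ & _ & B1 & _).
    destruct (inv_picard k) as (_ & _ & _ & B2 & _).
    specialize (B1 x t). specialize (B2 x t).
    apply Rabs_le_between in B1, B2. apply Rabs_le; lra.
  - intros d N Hd H. exists (S N). intros m k x t Hm Hk.
    destruct m as [|m]; [lia|]. destruct k as [|k]; [lia|].
    destruct (inv_picard m) as (C1 & _ & _ & B1 & _).
    destruct (inv_picard k) as (C2 & _ & _ & B2 & _).
    rewrite !V_S.
    replace (v0 x t + wave (source W phi (V m)) x t - (v0 x t + wave (source W phi (V k)) x t))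
      with (wave (source W phi (V m)) x t - wave (source W phi (V k)) x t) by ring.
    apply Rle_trans with (d / 2); [|lra].
    apply source_contract; auto; try lra.
    intros y s. apply H; lia.
Qed.

Let phi'_unif (e : R) : 0 < e -> exists d, 0 < d /\ forall a b,
  Rabs a <= rho -> Rabs b <= rho -> Rabs (a - b) <= d ->
  Rabs (phi' a - phi' b) <= e.
Proof.
  intros He.
  destruct (Heine phi' (fun c => -rho <= c <= rho) (compact_P3 _ _)) with
    (eps := mkposreal e He) as [d Hd].
  { intros s _. apply continuity_pt_filterlim, phi'_cont. }
  pose proof (cond_pos d).
  exists (d / 2). split; [lra|]. intros a b Ha Hb Hab.
  apply Rlt_le, (Hd a b); try (apply Rabs_le_between; auto). lra.
Qed.

(** The difference of two steps is bounded by half of the previous difference,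
    plus terms that involve only [v_m - v_k] and the modulus of continuity of
    [phi'], both small far out in the sequence.  They are made smaller than
    [d / 8] each, which leaves [d / 2 + d / 8 + d / 8 = 3 / 4 * d]. *)
Let Vx_cauchy (e : R) : 0 < e -> exists N, osc_le Vx N e.
Proof.
  apply (osc_geometric_cauchy Vx (2 * Bw)).
  - intros m k x t _ _.
    destruct (inv_picard m) as (_ & _ & _ & _ & B1 & _).
    destruct (inv_picard k) as (_ & _ & _ & _ & B2 & _).
    specialize (B1 x t). specialize (B2 x t).
    apply Rabs_le_between in B1, B2. apply Rabs_le; lra.
  - intros d N Hd H.
    set (eta := d / (8 * (J * Bw + 1))).
    assert (HJB : 0 <= J * Bw) by (apply Rmult_le_pos; auto).
    assert (Heta : 0 < eta) by (apply Rdiv_lt_0_compat; lra).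
    assert (Eeta : eta * (J * Bw + 1) = d / 8) by (unfold eta; field; lra).
    destruct (phi'_unif eta Heta) as [d1 [Hd1 Hu]].
    set (d2 := d / (8 * (K * q + 1))).
    assert (HKq : 0 <= K * q) by (apply Rmult_le_pos; auto).
    assert (Hd2 : 0 < d2) by (apply Rdiv_lt_0_compat; lra).
    assert (Ed2 : d2 * (K * q + 1) = d / 8) by (unfold d2; field; lra).
    destruct (V_cauchy (Rmin d1 d2)) as [M HM]; [apply Rmin_pos; auto|].
    exists (S (max N M)). intros m k x t Hm Hk.
    destruct m as [|m]; [lia|]. destruct k as [|k]; [lia|].
    destruct (inv_picard m) as (C1 & D1 & _ & B1 & E1 & _).
    destruct (inv_picard k) as (C2 & D2 & _ & B2 & E2 & _).
    rewrite !Vx_S.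
    match goal with |- Rabs ?z <= _ => replace z with
      (wave (source_dx W W' phi phi' (V m) (Vx m)) x t -
       wave (source_dx W W' phi phi' (V k) (Vx k)) x t) by ring end.
    rewrite <- wave_minus by auto.
    apply Rle_trans with ((eta * Bw + q * d) * J + (q * d2) * K).
    2:{ assert (q * d * J <= d / 2) by nra. nra. }
    apply (wave_bound_two _ W (fun x => Rabs (W' x))); auto using cont2_minus; try nra.
    intros y s. unfold source_dx.
    set (a := V m y s). set (b := V k y s). set (a' := Vx m y s). set (b' := Vx k y s).
    assert (Hab : Rabs (a - b) <= Rmin d1 d2) by (apply HM; lia).
    pose proof (Rmin_l d1 d2). pose proof (Rmin_r d1 d2).
    assert (F1 : Rabs (phi a - phi b) <= q * d2).
    { eapply Rle_trans; [apply phi_lipschitz; [apply B1|apply B2]|].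
      apply Rmult_le_compat_l; auto. lra. }
    assert (F2 : Rabs (phi' a - phi' b) <= eta).
    { apply Hu; [apply B1 | apply B2 | lra]. }
    assert (F3 : Rabs (phi' b) <= q) by apply phi'_bound, B2.
    assert (F4 : Rabs (a' - b') <= d) by (apply H; lia).
    assert (F5 : Rabs a' <= Bw) by apply E1.
    match goal with |- Rabs ?z <= _ => replace z with
      (W y * ((phi' a - phi' b) * a' + phi' b * (a' - b'))
       + W' y * (phi a - phi b)) by ring end.
    eapply Rle_trans; [apply Rabs_triang|].
    apply Rplus_le_compat.
    + rewrite Rabs_mult, (Rabs_right (W y)) by (apply Rle_ge; auto).
      rewrite (Rmult_comm _ (W y)). apply Rmult_le_compat_l; auto.
      eapply Rle_trans; [apply Rabs_triang|]. rewrite !Rabs_mult.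
      apply Rplus_le_compat; apply Rmult_le_compat; auto using Rabs_pos.
    + rewrite Rabs_mult, Rmult_comm.
      apply Rmult_le_compat_r; auto using Rabs_pos.
Qed.

(** Uniform convergence of the iterates and of their derivatives makes the limit
    C^1 in [x]. *)
Lemma picard_fixed_point : exists v vx : R -> R -> R,
  cont2 v /\ cont2 vx /\ (forall x t, is_derive (fun y => v y t) x (vx x t)) /\
  cone_supp r v /\
  (forall x t, v x t = v0 x t + wave (source W phi v) x t).
Proof.
  destruct (cauchy_unif_lim V V_cauchy) as [v Hv].
  destruct (cauchy_unif_lim Vx Vx_cauchy) as [w Hw].
  assert (CV : forall n, cont2 (V n)) by (intros n; apply inv_picard).
  assert (CVx : forall n, cont2 (Vx n)) by (intros n; apply inv_picard).
  assert (Cv : cont2 v) by exact (unif_lim_cont2 _ _ Hv CV).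
  assert (BV : forall n x t, Rabs (V n x t) <= rho) by (intros n; apply inv_picard).
  assert (Bv : forall x t, Rabs (v x t) <= rho) by exact (unif_lim_bound _ _ _ Hv BV).
  exists v, w. refine (conj Cv (conj _ (conj _ (conj _ _)))).
  - exact (unif_lim_cont2 _ _ Hw CVx).
  - apply (unif_lim_is_derive V Vx); auto. intros n; apply inv_picard.
  - intros x t Hx. apply cond_eq. intros e He.
    destruct (Hv (e / 2)) as [N HN]; [lra|]. specialize (HN N x t (le_n _)).
    destruct (inv_picard N) as (_ & _ & _ & _ & _ & S).
    rewrite S in HN by auto. rewrite Rabs_minus_sym. lra.
  - intros x t. apply cond_eq. intros e He.
    destruct (Hv (e / 2)) as [N HN]; [lra|].
    pose proof (HN (S N) x t (Nat.le_succ_diag_r N)) as A. rewrite V_S in A.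
    assert (B : Rabs (wave (source W phi (V N)) x t - wave (source W phi v) x t) <= e / 2 / 2).
    { apply source_contract; auto; lra. }
    apply Rabs_le_between in A, B. apply Rabs_def1; lra.
Qed.

End Picard.

(** * From the space derivative to the solution *)

Record C2_plane (u ux ut uxx uxt utt : R -> R -> R) : Prop := {
  c2_u : cont2 u; c2_ux : cont2 ux; c2_ut : cont2 ut;
  c2_uxx : cont2 uxx; c2_uxt : cont2 uxt; c2_utt : cont2 utt;
  d_u_x : forall x t, is_derive (fun y => u y t) x (ux x t);
  d_u_t : forall x t, is_derive (u x) t (ut x t);
  d_ux_x : forall x t, is_derive (fun y => ux y t) x (uxx x t);
  d_ux_t : forall x t, is_derive (ux x) t (uxt x t);
  d_ut_x : forall x t, is_derive (fun y => ut y t) x (uxt x t);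
  d_ut_t : forall x t, is_derive (ut x) t (utt x t) }.

(** The [x]-derivative of the free wave with data [F] and [G], where [F1] is the
    derivative of [F].  The [t]-derivative of the free wave is the same
    expression with the two arguments exchanged.  The coefficient [-1]
    matches [duhamel (-1)]. *)
Definition dalembert_dx (F1 G : R -> R) (x t : R) : R :=
  / 2 * (F1 (x + t) + F1 (x + -1 * t) + (G (x + t) - G (x + -1 * t))).

Lemma cont2_dalembert_dx (A B : R -> R) :
  (forall x, continuous A x) -> (forall x, continuous B x) ->
  cont2 (dalembert_dx A B).
Proof.
  intros HA HB.
  assert (P : cont2 (fun x t => x + t)) by auto using cont2_plus, cont2_fst, cont2_snd.
  assert (M : cont2 (fun x t => x + -1 * t))
    by auto using cont2_plus, cont2_mult, cont2_const, cont2_fst, cont2_snd.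
  apply cont2_mult; [apply cont2_const|].
  apply cont2_plus; [apply cont2_plus | apply cont2_minus]; apply cont2_comp1; auto.
Qed.

Lemma is_derive_dalembert_dx (A A' B B' : R -> R) (x t : R) :
  (forall x, is_derive A x (A' x)) -> (forall x, is_derive B x (B' x)) ->
  is_derive (fun y => dalembert_dx A B y t) x (dalembert_dx A' B' x t).
Proof.
  intros HA HB.
  assert (EA : forall z, ex_derive (fun x => A x) z) by (intros z; exists (A' z); apply HA).
  assert (EB : forall z, ex_derive (fun x => B x) z) by (intros z; exists (B' z); apply HB).
  unfold dalembert_dx. auto_derive.
  - repeat split; auto.
  - rewrite !(is_derive_unique (fun x => A x) _ _ (HA _)).
    rewrite !(is_derive_unique (fun x => B x) _ _ (HB _)). ring.
Qed.

Lemma is_derive_dalembert_dt (A A' B B' : R -> R) (x t : R) :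
  (forall x, is_derive A x (A' x)) -> (forall x, is_derive B x (B' x)) ->
  is_derive (dalembert_dx A B x) t (dalembert_dx B' A' x t).
Proof.
  intros HA HB.
  assert (EA : forall z, ex_derive (fun x => A x) z) by (intros z; exists (A' z); apply HA).
  assert (EB : forall z, ex_derive (fun x => B x) z) by (intros z; exists (B' z); apply HB).
  unfold dalembert_dx. auto_derive.
  - repeat split; auto.
  - rewrite !(is_derive_unique (fun x => A x) _ _ (HA _)).
    rewrite !(is_derive_unique (fun x => B x) _ _ (HB _)). ring.
Qed.

(** The contribution to [u_t] of the source [n] in Duhamel's formula. *)
Definition cowave (n : R -> R -> R) (x t : R) : R :=
  / 2 * (duhamel 1 n x t + duhamel (-1) n x t).

Lemma cont2_cowave (n : R -> R -> R) : cont2 n -> cont2 (cowave n).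
Proof.
  intros Hn. apply cont2_mult; auto using cont2_plus, cont2_duhamel, cont2_const.
Qed.

Lemma is_derive_cowave_x (n nx : R -> R -> R) (x t : R) :
  cont2 n -> cont2 nx ->
  (forall x t, is_derive (fun y => n y t) x (nx x t)) ->
  is_derive (fun y => cowave n y t) x (cowave nx x t).
Proof.
  intros Hn Hnx Hd. unfold cowave.
  apply (is_derive_scal (fun y => duhamel 1 n y t + duhamel (-1) n y t)).
  apply (is_derive_plus (fun y => duhamel 1 n y t) (fun y => duhamel (-1) n y t));
    apply is_derive_duhamel_x; auto.
Qed.

Lemma is_derive_cowave_t (n nx : R -> R -> R) (x t : R) :
  cont2 n -> cont2 nx ->
  (forall x t, is_derive (fun y => n y t) x (nx x t)) ->
  is_derive (cowave n x) t (n x t + wave nx x t).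
Proof.
  intros Hn Hnx Hd. unfold cowave, wave.
  replace (n x t + / 2 * (duhamel 1 nx x t - duhamel (-1) nx x t)) with
    (/ 2 * ((n x t + 1 * duhamel 1 nx x t) + (n x t + -1 * duhamel (-1) nx x t)))
    by field.
  apply (is_derive_scal (fun r => duhamel 1 n x r + duhamel (-1) n x r)).
  apply (is_derive_plus (fun r => duhamel 1 n x r) (fun r => duhamel (-1) n x r));
    apply is_derive_duhamel_t; auto.
Qed.

(** The two end point terms cancel, so that [u_x] and [u_t] have the same mixed
    derivative. *)
Lemma is_derive_wave_t (n nx : R -> R -> R) (x t : R) :
  cont2 n -> cont2 nx ->
  (forall x t, is_derive (fun y => n y t) x (nx x t)) ->
  is_derive (wave n x) t (cowave nx x t).
Proof.
  intros Hn Hnx Hd. unfold cowave, wave.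
  replace (/ 2 * (duhamel 1 nx x t + duhamel (-1) nx x t)) with
    (/ 2 * ((n x t + 1 * duhamel 1 nx x t) - (n x t + -1 * duhamel (-1) nx x t)))
    by field.
  apply (is_derive_scal (fun r => duhamel 1 n x r - duhamel (-1) n x r)).
  apply (is_derive_minus (fun r => duhamel 1 n x r) (fun r => duhamel (-1) n x r));
    apply is_derive_duhamel_t; auto.
Qed.

Section Integrate.

Variables (F F1 F2 G G1 : R -> R) (n nx v : R -> R -> R).
Hypothesis F_derive : forall x, is_derive F x (F1 x).
Hypothesis F1_derive : forall x, is_derive F1 x (F2 x).
Hypothesis G_derive : forall x, is_derive G x (G1 x).
Hypothesis F2_cont : forall x, continuous F2 x.
Hypothesis G1_cont : forall x, continuous G1 x.

Lemma at_time_0 (x : R) :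
  dalembert_dx F1 G x 0 = F1 x /\ dalembert_dx G F1 x 0 = G x /\
  wave n x 0 = 0 /\ cowave n x 0 = 0.
Proof.
  unfold dalembert_dx, wave, cowave, duhamel.
  rewrite !RInt_point. unfold zero; simpl.
  replace (x + -1 * 0) with x by ring. rewrite Rplus_0_r.
  repeat split; field.
Qed.

Hypothesis n_cont : cont2 n.
Hypothesis nx_cont : cont2 nx.
Hypothesis n_derive : forall x t, is_derive (fun y => n y t) x (nx x t).
Hypothesis v_eq : forall x t, v x t = dalembert_dx F1 G x t + wave n x t.

(** Time integration of [u_t] gives [u_t] back at once, and [u_x = v] because
    [u_tx = v_t] and because [v] starts from [F1].  The equation itself is the end
    point term [n] in [u_tt]. *)
Lemma wave_equation_solution : exists u ut uxx uxt utt : R -> R -> R,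
  C2_plane u v ut uxx uxt utt /\
  (forall x t, utt x t - uxx x t = n x t) /\
  (forall x, u x 0 = F x) /\ (forall x, ut x 0 = G x).
Proof.
  assert (F1_cont : forall x, continuous F1 x).
  { intros x. exact (is_derive_continuous _ _ _ (F1_derive x)). }
  assert (F_cont : forall x, continuous F x).
  { intros x. exact (is_derive_continuous _ _ _ (F_derive x)). }
  assert (G_cont : forall x, continuous G x).
  { intros x. exact (is_derive_continuous _ _ _ (G_derive x)). }
  set (ut := fun x t => dalembert_dx G F1 x t + cowave n x t).
  set (uxx := fun x t => dalembert_dx F2 G1 x t + wave nx x t).
  set (uxt := fun x t => dalembert_dx G1 F2 x t + cowave nx x t).
  set (utt := fun x t => dalembert_dx F2 G1 x t + (n x t + wave nx x t)).
  set (u := fun x t => F x + RInt (ut x) 0 t).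
  assert (Cut : cont2 ut)
    by (apply cont2_plus; [apply cont2_dalembert_dx | apply cont2_cowave]; auto).
  assert (Cuxt : cont2 uxt)
    by (apply cont2_plus; [apply cont2_dalembert_dx | apply cont2_cowave]; auto).
  assert (Cuxx : cont2 uxx)
    by (apply cont2_plus; [apply cont2_dalembert_dx | apply cont2_wave]; auto).
  assert (Cv : cont2 v).
  { apply (cont2_ext (fun x t => dalembert_dx F1 G x t + wave n x t)); auto.
    apply cont2_plus; [apply cont2_dalembert_dx | apply cont2_wave]; auto. }
  assert (Dvt : forall x t, is_derive (v x) t (uxt x t)).
  { intros x t.
    apply (is_derive_ext (fun t => dalembert_dx F1 G x t + wave n x t)); auto.
    apply (is_derive_plus (fun t => dalembert_dx F1 G x t) (wave n x)).
    - apply is_derive_dalembert_dt; auto.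
    - apply is_derive_wave_t; auto. }
  assert (Dutx : forall x t, is_derive (fun y => ut y t) x (uxt x t)).
  { intros x t.
    apply (is_derive_plus (fun y => dalembert_dx G F1 y t) (fun y => cowave n y t)).
    - apply is_derive_dalembert_dx; auto.
    - apply is_derive_cowave_x; auto. }
  exists u, ut, uxx, uxt, utt. split; [constructor|split; [|split]]; auto.
  - apply cont2_plus; auto using cont2_RInt. apply cont2_comp1; auto using cont2_fst.
  - apply cont2_plus; [apply cont2_dalembert_dx | apply cont2_plus]; auto.
    apply cont2_wave; auto.
  - intros x t. unfold u.
    replace (v x t) with (F1 x + RInt (uxt x) 0 t).
    2:{ rewrite (is_RInt_unique (uxt x) 0 t (v x t - v x 0)).
        - rewrite (v_eq x 0). destruct (at_time_0 x) as (-> & _ & -> & _). ring.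
        - apply (is_RInt_derive (v x) (uxt x)); auto.
          intros; apply cont2_section; auto. }
    apply (is_derive_plus F (fun y => RInt (ut y) 0 t)); auto.
    rewrite (RInt_ext (uxt x) (fun s => Derive (fun y => ut y s) x)).
    2:{ intros s _. symmetry. apply is_derive_unique, Dutx. }
    apply (is_derive_RInt_param ut 0 t x).
    + apply filter_forall. intros y s _. eexists. apply Dutx.
    + intros s _. apply (continuity_2d_pt_ext uxt); auto.
      intros y z. symmetry. apply is_derive_unique, Dutx.
    + apply filter_forall. intros y. apply cont_ex_RInt, cont2_section; auto.
  - intros x t. unfold u. evar_last.
    + apply (is_derive_plus (fun _ => F x) (fun t => RInt (ut x) 0 t)).
      * apply is_derive_const.
      * apply (is_derive_RInt (ut x) _ 0).
        -- apply filter_forall. intros y.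
           apply (@RInt_correct R_CompleteNormedModule), cont_ex_RInt, cont2_section; auto.
        -- apply cont2_section; auto.
    + apply plus_zero_l.
  - intros x t.
    apply (is_derive_ext (fun y => dalembert_dx F1 G y t + wave n y t)); auto.
    apply (is_derive_plus (fun y => dalembert_dx F1 G y t) (fun y => wave n y t)).
    + apply is_derive_dalembert_dx; auto.
    + apply is_derive_wave_x; auto.
  - intros x t.
    apply (is_derive_plus (dalembert_dx G F1 x) (cowave n x)).
    + apply is_derive_dalembert_dt; auto.
    + apply is_derive_cowave_t; auto.
  - intros x t. unfold utt, uxx. ring.
  - intros x. unfold u. rewrite RInt_point. unfold zero; simpl. ring.
  - intros x. unfold ut. destruct (at_time_0 x) as (_ & -> & _ & ->). ring.
Qed.

End Integrate.

(** The smallness condition couples the mass [J] of the weight to the size of [F1]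
    and [G] alone; [m1] and [K] serve to keep the derivatives of the iterates
    bounded. *)
Lemma global_solution (F F1 F2 G G1 W W' phi phi' : R -> R) (rho m1 J K q r : R) :
  (forall x, is_derive F x (F1 x)) -> (forall x, is_derive F1 x (F2 x)) ->
  (forall x, continuous F2 x) ->
  (forall x, is_derive G x (G1 x)) -> (forall x, continuous G1 x) ->
  (forall x y, Rabs (F1 x) + Rabs (G y) <= rho / 2) ->
  (forall x y, Rabs (F2 x) + Rabs (G1 y) <= m1) ->
  (forall x, r < Rabs x -> F1 x = 0) -> (forall x, r < Rabs x -> G x = 0) ->
  (forall x, is_derive W x (W' x)) -> (forall x, continuous W' x) ->
  (forall x, 0 <= W x) -> mass_le W J -> mass_le (fun x => Rabs (W' x)) K ->
  (forall s, is_derive phi s (phi' s)) -> (forall s, continuous phi' s) ->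
  phi 0 = 0 -> (forall s, Rabs s <= rho -> Rabs (phi' s) <= q) ->
  J * q <= 1 / 2 ->
  exists u ux ut uxx uxt utt : R -> R -> R,
  C2_plane u ux ut uxx uxt utt /\
  (forall x t, utt x t - uxx x t = W x * phi (ux x t)) /\
  (forall x, u x 0 = F x) /\ (forall x, ut x 0 = G x) /\
  cone_supp r ux.
Proof.
  intros HF HF1 HF2 HG HG1 Bd Bd1 SF SG HW HW' W0 MW MW' Hphi Hphi' P0 Bq small.
  assert (CF1 : forall x, continuous F1 x).
  { intros x. exact (is_derive_continuous _ _ _ (HF1 x)). }
  assert (CG : forall x, continuous G x).
  { intros x. exact (is_derive_continuous _ _ _ (HG x)). }
  assert (Bound : forall A B m, (forall x y, Rabs (A x) + Rabs (B y) <= m) ->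
    forall x t, Rabs (dalembert_dx A B x t) <= m).
  { intros A B m H x t. unfold dalembert_dx.
    pose proof (H (x + t) (x + t)) as H1.
    pose proof (H (x + -1 * t) (x + -1 * t)) as H2.
    assert (T : forall a b m, Rabs a + Rabs b <= m -> - m <= a + b <= m /\ - m <= a - b <= m).
    { clear. intros a b m H. pose proof (Rle_abs a). pose proof (Rle_abs b).
      pose proof (Rle_abs (- a)). pose proof (Rle_abs (- b)). rewrite Rabs_Ropp in *. lra. }
    apply T in H1, H2. apply Rabs_le. lra. }
  destruct (picard_fixed_point (dalembert_dx F1 G) (dalembert_dx F2 G1)
    W W' phi phi' rho m1 J K q r) as (v & vx & Cv & Cvx & Dv & Sv & Ev); auto.
  - apply cont2_dalembert_dx; auto.
  - apply cont2_dalembert_dx; auto.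
  - intros. apply is_derive_dalembert_dx; auto.
  - intros x t Hx. unfold dalembert_dx.
    assert (A1 : r < Rabs (x + t)).
    { pose proof (Rabs_triang (x + t) (- t)). rewrite Rabs_Ropp in H.
      replace (x + t + - t) with x in H by ring. lra. }
    assert (A2 : r < Rabs (x + -1 * t)).
    { pose proof (Rabs_triang (x + -1 * t) t).
      replace (x + -1 * t + t) with x in H by ring. lra. }
    rewrite !SF, !SG by auto. ring.
  - assert (CW : forall x, continuous W x).
    { intros x. exact (is_derive_continuous _ _ _ (HW x)). }
    assert (Cphi : forall x, continuous phi x).
    { intros x. exact (is_derive_continuous _ _ _ (Hphi x)). }
    destruct (wave_equation_solution F F1 F2 G G1 (source W phi v)
      (source_dx W W' phi phi' v vx) v) as (u & ut & uxx & uxt & utt & C & E & I0 & I1); auto.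
    + apply cont2_source; auto.
    + apply cont2_source_dx; auto.
    + intros. apply is_derive_source; auto.
    + exists u, v, ut, uxx, uxt, utt. auto.
Qed.

(** * Restriction to a strip *)

Lemma cont2_strip (T : R) (u : R -> R -> R) : cont2 u -> continuous_strip T u.
Proof.
  intros Hu x t _.
  apply (filterlim_filter_le_1 (F := locally (x, t)) (fun z : R * R => u (fst z) (snd z))).
  - apply filter_le_within.
  - apply continuity_2d_pt_filterlim, Hu.
Qed.

Lemma is_derive_is_dx (T : R) (u ux : R -> R -> R) :
  (forall x t, is_derive (fun y => u y t) x (ux x t)) -> is_dx T u ux.
Proof. intros H x t _. apply H. Qed.

(** A two-sided derivative is in particular a derivative from the right at time
    0. *)
Lemma is_derive_is_dt (T : R) (u ut : R -> R -> R) :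
  (forall x t, is_derive (u x) t (ut x t)) -> is_dt T u ut.
Proof.
  intros H x t _.
  apply (filterlim_filter_le_1 (F := locally' t) (fun s => (u x s - u x t) / (s - t)));
    [apply filter_le_within|].
  specialize (H x t). apply is_derive_Reals in H.
  intros P [eps HP].
  destruct (H eps (cond_pos eps)) as [d Hd]. exists d.
  intros y Hy Hne. apply HP.
  change (Rabs ((u x y - u x t) / (y - t) - ut x t) < eps).
  replace (u x y) with (u x (t + (y - t))) by (f_equal; ring).
  apply Hd; auto. lra.
Qed.

Lemma C2_plane_strip (T : R) (u ux ut uxx uxt utt : R -> R -> R) :
  C2_plane u ux ut uxx uxt utt -> Ck_strip 2 T u.
Proof.
  intros []. split; [now apply cont2_strip|]. exists ux, ut.
  split; [now apply is_derive_is_dx|]. split; [now apply is_derive_is_dt|].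
  split; (split; [now apply cont2_strip|]).
  - exists uxx, uxt.
    split; [now apply is_derive_is_dx|]. split; [now apply is_derive_is_dt|].
    split; (split; [now apply cont2_strip|exact I]).
  - exists uxt, utt.
    split; [now apply is_derive_is_dx|]. split; [now apply is_derive_is_dt|].
    split; (split; [now apply cont2_strip|exact I]).
Qed.

(** * The power nonlinearity *)

Lemma Rpower_pos (x y : R) : 0 < Rpower x y.
Proof. apply exp_pos. Qed.

Lemma Rpower_le_of_le_root (x y s : R) :
  0 < s -> 0 < x -> 0 < y -> x <= Rpower y (/ s) -> Rpower x s <= y.
Proof.
  intros Hs Hx Hy H.
  replace y with (Rpower (Rpower y (/ s)) s).
  - apply Rle_Rpower_l; lra.
  - rewrite Rpower_mult, Rinv_l by lra. apply Rpower_1; auto.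
Qed.

Lemma abs_pow_0 (p : R) : abs_pow 0 p = 0.
Proof. unfold abs_pow. destruct (Req_EM_T 0 0); lra. Qed.

Lemma abs_pow_neq_0 (s p : R) : s <> 0 -> abs_pow s p = Rpower (Rabs s) p.
Proof. intros H. unfold abs_pow. destruct (Req_EM_T s 0); lra. Qed.

Lemma abs_pow_nonneg (s p : R) : 0 <= abs_pow s p.
Proof.
  unfold abs_pow. destruct (Req_EM_T s 0); [lra|apply Rlt_le, Rpower_pos].
Qed.

Lemma abs_pow_opp (s p : R) : abs_pow (- s) p = abs_pow s p.
Proof.
  unfold abs_pow. rewrite Rabs_Ropp.
  destruct (Req_EM_T s 0), (Req_EM_T (- s) 0); auto; exfalso; lra.
Qed.

Lemma abs_pow_le (s r p : R) :
  0 < p -> 0 < r -> Rabs s <= r -> abs_pow s p <= Rpower r p.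
Proof.
  intros Hp Hr H. unfold abs_pow. destruct (Req_EM_T s 0) as [E|E].
  - apply Rlt_le, Rpower_pos.
  - apply Rle_Rpower_l; [lra|]. split; auto. now apply Rabs_pos_lt.
Qed.

Lemma abs_pow_small (p e : R) : 0 < p -> 0 < e ->
  forall s, Rabs s <= Rpower e (/ p) -> abs_pow s p <= e.
Proof.
  intros Hp He s Hs. unfold abs_pow. destruct (Req_EM_T s 0) as [E|E]; [lra|].
  apply Rpower_le_of_le_root; auto. now apply Rabs_pos_lt.
Qed.

Lemma locally_pos (s : R) : 0 < s -> locally s (fun r => 0 < r).
Proof. intros H. apply (open_gt 0 s H). Qed.

(** The value 0 at 0 comes from [sign 0 = 0]. *)
Definition abs_pow_deriv (p s : R) : R := p * (sign s * abs_pow s (p - 1)).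

Lemma abs_abs_pow_deriv_le (p s : R) : 0 <= p ->
  Rabs (abs_pow_deriv p s) <= p * abs_pow s (p - 1).
Proof.
  intros Hp. unfold abs_pow_deriv.
  rewrite !Rabs_mult, (Rabs_right p) by lra.
  rewrite (Rabs_right (abs_pow s (p - 1))) by apply Rle_ge, abs_pow_nonneg.
  apply Rmult_le_compat_l; auto.
  rewrite <- (Rmult_1_l (abs_pow s (p - 1))) at 2.
  apply Rmult_le_compat_r; [apply abs_pow_nonneg|]. apply Rabs_le.
  destruct (total_order_T s 0) as [[H|H]|H].
  - rewrite sign_eq_m1 by auto; lra.
  - subst s. rewrite sign_0; lra.
  - rewrite sign_eq_1 by auto; lra.
Qed.

Lemma is_derive_abs_pow_pos (p s : R) : 0 < s ->
  is_derive (fun s => abs_pow s p) s (abs_pow_deriv p s).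
Proof.
  intros Hs. apply (is_derive_ext_loc (fun s => Rpower s p)).
  - apply (filter_imp (fun r => 0 < r)); [|now apply locally_pos].
    intros r Hr. rewrite abs_pow_neq_0, Rabs_right by lra. reflexivity.
  - unfold abs_pow_deriv. rewrite sign_eq_1, Rmult_1_l by auto.
    rewrite abs_pow_neq_0, Rabs_right by lra.
    apply is_derive_Reals, derivable_pt_lim_power, Hs.
Qed.

(** Away from 0 this is the rule for powers, extended by parity; at 0 the difference
    quotient is [|h|^(p-1)] up to sign, which tends to 0 as [p > 1]. *)
Lemma is_derive_abs_pow (p s : R) : 1 < p ->
  is_derive (fun s => abs_pow s p) s (abs_pow_deriv p s).
Proof.
  intros Hp. destruct (total_order_T s 0) as [[Hs|Hs]|Hs].
  - apply (is_derive_ext (fun s => abs_pow (- s) p)).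
    { intros r. apply abs_pow_opp. }
    evar_last.
    + apply (is_derive_comp (fun s => abs_pow s p) (fun s => - s)).
      * apply is_derive_abs_pow_pos. lra.
      * auto_derive; auto.
    + unfold abs_pow_deriv. rewrite sign_opp, abs_pow_opp.
      unfold scal; simpl; unfold mult; simpl. ring.
  - subst s. unfold abs_pow_deriv. rewrite sign_0, Rmult_0_l, Rmult_0_r.
    apply is_derive_Reals. intros e He.
    assert (Hd : 0 < Rpower (e / 2) (/ (p - 1))) by apply Rpower_pos.
    exists (mkposreal _ Hd). intros h Hh0 Hh. simpl in Hh.
    rewrite Rplus_0_l, abs_pow_0, !Rminus_0_r.
    assert (E : abs_pow h (p - 1) <= e / 2) by (apply abs_pow_small; lra).
    rewrite abs_pow_neq_0 in * by auto.
    unfold Rdiv. rewrite Rabs_mult, Rabs_inv.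
    assert (Ah : 0 < Rabs h) by now apply Rabs_pos_lt.
    rewrite (Rabs_right (Rpower _ _)) by (apply Rle_ge, Rlt_le, Rpower_pos).
    replace p with ((p - 1) + 1) at 1 by ring.
    rewrite Rpower_plus, Rpower_1 by auto.
    replace (Rpower (Rabs h) (p - 1) * Rabs h * / Rabs h) with
      (Rpower (Rabs h) (p - 1)) by (field; lra).
    lra.
  - now apply is_derive_abs_pow_pos.
Qed.

Lemma continuous_abs_pow_deriv (p s : R) : 1 < p -> continuous (abs_pow_deriv p) s.
Proof.
  intros Hp.
  assert (Pos : forall s, 0 < s -> continuous (abs_pow_deriv p) s).
  { clear s. intros s Hs.
    apply (continuous_ext_loc _ (fun s => p * abs_pow s (p - 1))).
    - apply (filter_imp (fun r => 0 < r)); [|now apply locally_pos].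
      intros r Hr. unfold abs_pow_deriv. now rewrite sign_eq_1, Rmult_1_l.
    - apply (continuous_scal_r p (fun s => abs_pow s (p - 1))).
      exact (is_derive_continuous _ _ _ (is_derive_abs_pow_pos (p - 1) s Hs)). }
  destruct (total_order_T s 0) as [[Hs|Hs]|Hs].
  - apply (continuous_ext (fun s => - abs_pow_deriv p (- s))).
    { intros r. change (- abs_pow_deriv p (- r) = abs_pow_deriv p r).
      unfold abs_pow_deriv. rewrite sign_opp, abs_pow_opp. ring. }
    apply (continuous_opp (fun s => abs_pow_deriv p (- s))).
    apply (continuous_comp (fun s => - s) (abs_pow_deriv p)).
    + apply (is_derive_continuous (fun s => - s) s (-1)). auto_derive; auto; ring.
    + apply Pos. lra.
  - subst s. apply filterlim_locally. intros eps. pose proof (cond_pos eps).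
    assert (Hd : 0 < Rpower (eps / (2 * p)) (/ (p - 1))) by apply Rpower_pos.
    exists (mkposreal _ Hd). intros r Hr.
    change (Rabs (r - 0) < Rpower (eps / (2 * p)) (/ (p - 1))) in Hr.
    rewrite Rminus_0_r in Hr.
    change (Rabs (abs_pow_deriv p r - abs_pow_deriv p 0) < eps).
    unfold abs_pow_deriv at 2. rewrite sign_0, Rmult_0_l, Rmult_0_r, Rminus_0_r.
    assert (E : abs_pow r (p - 1) <= eps / (2 * p)).
    { apply abs_pow_small; try lra. apply Rdiv_lt_0_compat; lra. }
    apply Rle_lt_trans with (p * (eps / (2 * p))).
    + eapply Rle_trans; [apply abs_abs_pow_deriv_le; lra|].
      apply Rmult_le_compat_l; lra.
    + replace (p * (eps / (2 * p))) with (eps / 2) by (field; lra). lra.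
  - now apply Pos.
Qed.

Lemma abs_pow_deriv_bound (p s r : R) : 1 < p -> 0 < r -> Rabs s <= r ->
  Rabs (abs_pow_deriv p s) <= p * Rpower r (p - 1).
Proof.
  intros Hp Hr Hs. eapply Rle_trans; [apply abs_abs_pow_deriv_le; lra|].
  apply Rmult_le_compat_l; [lra|]. apply abs_pow_le; lra.
Qed.

(** * A continuously differentiable cutoff *)

(** The building block of the cutoff: the simplest C^1 function that vanishes on a
    half-line and is positive on the other one. *)
Definition pos_sq (z : R) : R := Rmax 0 z ^ 2.

(** The error of the linear approximation is at most [h ^ 2] at every point, the
    corner included. *)
Lemma is_derive_pos_sq (z : R) : is_derive pos_sq z (2 * Rmax 0 z).
Proof.
  apply is_derive_Reals. intros e He. exists (mkposreal e He).
  intros h Hh0 Hh. simpl in Hh.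
  apply Rle_lt_trans with (Rabs h); auto.
  assert (Ah : 0 < Rabs h) by now apply Rabs_pos_lt.
  replace ((pos_sq (z + h) - pos_sq z) / h - 2 * Rmax 0 z) with
    ((pos_sq (z + h) - pos_sq z - 2 * Rmax 0 z * h) / h) by (field; auto).
  unfold Rdiv. rewrite Rabs_mult, Rabs_inv.
  apply Rmult_le_reg_r with (Rabs h); auto.
  rewrite Rmult_assoc, Rinv_l, Rmult_1_r by lra.
  replace (Rabs h * Rabs h) with (h * h)
    by (rewrite <- Rabs_mult, Rabs_right; nra).
  unfold pos_sq, Rmax. apply Rabs_le.
  destruct (Rle_dec 0 z), (Rle_dec 0 (z + h)); nra.
Qed.

Lemma pos_sq_nonneg (z : R) : 0 <= pos_sq z.
Proof. apply pow2_ge_0. Qed.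

Lemma pos_sq_nonpos (z : R) : z <= 0 -> pos_sq z = 0.
Proof. intros H. unfold pos_sq. rewrite Rmax_left by auto. ring. Qed.

Lemma continuous_Rmax0 (z : R) : continuous (fun z => 2 * Rmax 0 z) z.
Proof.
  apply (continuous_ext (fun z => z + Rabs z)).
  { intros r. unfold Rmax. destruct (Rle_dec 0 r).
    - rewrite Rabs_right; lra.
    - rewrite Rabs_left; lra. }
  apply (continuous_plus (fun z => z) Rabs). apply continuous_id. apply continuous_Rabs.
Qed.

(** The argument of the outer square is 1 for [|x| <= L] and at most 0 once
    [|x| >= L + 1]. *)
Definition cutoff (L x : R) : R := pos_sq (1 - pos_sq (x - L) - pos_sq (- x - L)).

Definition cutoff_deriv (L x : R) : R :=
  2 * Rmax 0 (1 - pos_sq (x - L) - pos_sq (- x - L)) *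
  (2 * Rmax 0 (- x - L) - 2 * Rmax 0 (x - L)).

Lemma is_derive_cutoff (L x : R) : is_derive (cutoff L) x (cutoff_deriv L x).
Proof.
  assert (D : forall z, Derive (fun z => pos_sq z) z = 2 * Rmax 0 z).
  { intros z. apply is_derive_unique, is_derive_pos_sq. }
  assert (E : forall z, ex_derive (fun z => pos_sq z) z).
  { intros z. eexists. apply is_derive_pos_sq. }
  unfold cutoff, cutoff_deriv. auto_derive.
  - repeat split; auto.
  - rewrite !D. ring_simplify. unfold Rminus. ring.
Qed.

Lemma continuous_cutoff_deriv (L x : R) : continuous (cutoff_deriv L) x.
Proof.
  assert (C : forall h : R -> R, (forall x, continuous h x) ->
    forall x, continuous (fun x => 2 * Rmax 0 (h x)) x).
  { intros h Hh y. apply (continuous_comp h (fun z => 2 * Rmax 0 z)); auto.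
    apply continuous_Rmax0. }
  assert (A1 : forall x, continuous (fun x => x - L) x).
  { intros y. apply (is_derive_continuous _ y 1). auto_derive; auto; ring. }
  assert (A2 : forall x, continuous (fun x => - x - L) x).
  { intros y. apply (is_derive_continuous _ y (-1)). auto_derive; auto; ring. }
  apply (continuous_mult
    (fun x => 2 * Rmax 0 (1 - pos_sq (x - L) - pos_sq (- x - L)))
    (fun x => 2 * Rmax 0 (- x - L) - 2 * Rmax 0 (x - L))).
  - apply C. clear x. intros x.
    assert (Q : forall h : R -> R, (forall x, continuous h x) ->
      forall x, continuous (fun x => pos_sq (h x)) x).
    { intros h Hh y. apply (continuous_comp h pos_sq); auto.
      exact (is_derive_continuous _ _ _ (is_derive_pos_sq _)). }
    apply (continuous_minus (fun x => 1 - pos_sq (x - L)) (fun x => pos_sq (- x - L))); auto.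
    apply (continuous_minus (fun _ => 1) (fun x => pos_sq (x - L))); auto.
    apply continuous_const.
  - apply (continuous_minus (fun x => 2 * Rmax 0 (- x - L)) (fun x => 2 * Rmax 0 (x - L)));
      auto.
Qed.

Lemma cutoff_one (L x : R) : Rabs x <= L -> cutoff L x = 1.
Proof.
  intros H. apply Rabs_le_between in H. unfold cutoff.
  rewrite (pos_sq_nonpos (x - L)), (pos_sq_nonpos (- x - L)) by lra.
  unfold pos_sq. rewrite Rmax_right by lra. ring.
Qed.

Lemma cutoff_range (L x : R) : 0 <= cutoff L x <= 1.
Proof.
  unfold cutoff.
  pose proof (pos_sq_nonneg (x - L)). pose proof (pos_sq_nonneg (- x - L)).
  split; [apply pos_sq_nonneg|].
  set (y := 1 - pos_sq (x - L) - pos_sq (- x - L)).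
  assert (y <= 1) by (unfold y; lra).
  unfold pos_sq, Rmax. destruct (Rle_dec 0 y); nra.
Qed.

Lemma cutoff_arg_nonpos (L x : R) : L + 1 <= Rabs x ->
  1 - pos_sq (x - L) - pos_sq (- x - L) <= 0.
Proof.
  intros H.
  pose proof (pos_sq_nonneg (x - L)). pose proof (pos_sq_nonneg (- x - L)).
  assert (Big : forall z, 1 <= z -> 1 <= pos_sq z).
  { intros z Hz. unfold pos_sq. rewrite Rmax_right by lra. nra. }
  unfold Rabs in H. destruct (Rcase_abs x).
  - pose proof (Big (- x - L) ltac:(lra)). lra.
  - pose proof (Big (x - L) ltac:(lra)). lra.
Qed.

Lemma cutoff_zero (L x : R) : L + 1 <= Rabs x -> cutoff L x = 0 /\ cutoff_deriv L x = 0.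
Proof.
  intros H. apply cutoff_arg_nonpos in H. split.
  - now apply pos_sq_nonpos.
  - unfold cutoff_deriv. rewrite (Rmax_left 0 (1 - _ - _)) by auto. ring.
Qed.

(** * The truncated weight and its mass *)

Lemma japanese_pos (x : R) : 0 < japanese x.
Proof. apply sqrt_lt_R0. pose proof (pow2_ge_0 x). lra. Qed.

Lemma japanese_bounds (x : R) :
  (1 + Rabs x) / 2 <= japanese x <= 1 + Rabs x.
Proof.
  pose proof (Rabs_pos x). pose proof (pow2_abs x) as E.
  assert (S : japanese x * japanese x = 1 + x ^ 2).
  { apply sqrt_sqrt. pose proof (pow2_ge_0 x). lra. }
  pose proof (japanese_pos x).
  split; apply Rsqr_incr_0_var; try lra; unfold Rsqr; nra.
Qed.

(** Comparable with [<x>^(-a)], but with an elementary primitive on the positive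
    axis. *)
Definition bracket (a x : R) : R := Rpower (1 + Rabs x) (- a).

Lemma continuous_bracket (a x : R) : continuous (bracket a) x.
Proof.
  apply (continuous_comp (fun x => 1 + Rabs x) (fun y => Rpower y (- a))).
  - apply (continuous_plus (fun _ => 1) Rabs). apply continuous_const. apply continuous_Rabs.
  - apply (is_derive_continuous _ _ (- a * Rpower (1 + Rabs x) (- a - 1))).
    apply is_derive_Reals, derivable_pt_lim_power. pose proof (Rabs_pos x). lra.
Qed.

(** [<x>] and [1 + |x|] differ by a factor between 1 and 2; the absolute value in
    [Rpower 2 (Rabs a)] covers both signs of [a]. *)
Lemma japanese_power_le (a x : R) :
  Rpower (japanese x) (- a) <= Rpower 2 (Rabs a) * bracket a x.
Proof.
  unfold bracket, Rpower. rewrite <- exp_plus.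
  pose proof (Rabs_pos x). pose proof (japanese_bounds x) as [B1 B2].
  pose proof (japanese_pos x).
  assert (L1 : ln (japanese x) <= ln (1 + Rabs x)) by (apply ln_le; lra).
  assert (L2 : ln (1 + Rabs x) <= ln 2 + ln (japanese x)).
  { rewrite <- ln_mult by lra. apply ln_le; lra. }
  assert (Le : - a * ln (japanese x) <= Rabs a * ln 2 + - a * ln (1 + Rabs x)).
  { set (d := ln (1 + Rabs x) - ln (japanese x)).
    assert (0 <= d <= ln 2) by (unfold d; lra).
    assert (a * d <= Rabs a * ln 2).
    { apply Rle_trans with (Rabs a * d).
      - apply Rmult_le_compat_r; [lra|apply Rle_abs].
      - apply Rmult_le_compat_l; [apply Rabs_pos|lra]. }
    unfold d in *. lra. }
  destruct Le as [Lt|Eq]; [left; now apply exp_increasing | right; now rewrite Eq].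
Qed.

Definition weight (a L x : R) : R := Rpower (japanese x) (- a) * cutoff L x.

Definition weight_deriv (a L x : R) : R :=
  - a * x / (1 + x ^ 2) * Rpower (japanese x) (- a) * cutoff L x +
  Rpower (japanese x) (- a) * cutoff_deriv L x.

Lemma is_derive_japanese_power (a x : R) :
  is_derive (fun x => Rpower (japanese x) (- a)) x
    (- a * x / (1 + x ^ 2) * Rpower (japanese x) (- a)).
Proof.
  pose proof (pow2_ge_0 x) as Hx.
  pose proof (japanese_pos x) as Hj. unfold japanese in Hj.
  assert (S : sqrt (1 + x ^ 2) * sqrt (1 + x ^ 2) = 1 + x ^ 2) by (apply sqrt_sqrt; lra).
  unfold Rpower, japanese. auto_derive.
  - repeat split; simpl in *; lra.
  - replace (1 + x * (x * 1)) with (1 + x ^ 2) by ring.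
    set (s := sqrt (1 + x ^ 2)) in *. rewrite <- S. field. lra.
Qed.

Lemma is_derive_weight (a L x : R) : is_derive (weight a L) x (weight_deriv a L x).
Proof.
  apply (is_derive_mult (fun x => Rpower (japanese x) (- a)) (cutoff L)).
  - apply is_derive_japanese_power.
  - apply is_derive_cutoff.
  - intros; apply Rmult_comm.
Qed.

Lemma continuous_weight_deriv (a L x : R) : continuous (weight_deriv a L) x.
Proof.
  assert (C1 : continuous (fun x => Rpower (japanese x) (- a)) x)
    by exact (is_derive_continuous _ _ _ (is_derive_japanese_power a x)).
  assert (C2 : continuous (fun x => - a * x / (1 + x ^ 2)) x).
  { apply (ex_derive_continuous (fun x : R => - a * x / (1 + x ^ 2))).
    auto_derive. pose proof (pow2_ge_0 x). simpl in *. lra. }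
  apply (continuous_plus
    (fun x => - a * x / (1 + x ^ 2) * Rpower (japanese x) (- a) * cutoff L x)
    (fun x => Rpower (japanese x) (- a) * cutoff_deriv L x)).
  - apply (continuous_mult (fun x => - a * x / (1 + x ^ 2) * Rpower (japanese x) (- a))
      (cutoff L)).
    + apply (continuous_mult (fun x => - a * x / (1 + x ^ 2))
        (fun x => Rpower (japanese x) (- a))); auto.
    + exact (is_derive_continuous _ _ _ (is_derive_cutoff L x)).
  - apply (continuous_mult (fun x => Rpower (japanese x) (- a)) (cutoff_deriv L)); auto.
    apply continuous_cutoff_deriv.
Qed.

(** A primitive of a nonnegative function with this support takes its values
    between 0 and the total integral. *)
Lemma mass_le_compact (W : R -> R) (l : R) :
  0 <= l -> (forall x, continuous W x) -> (forall x, 0 <= W x) ->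
  (forall x, l <= Rabs x -> W x = 0) -> mass_le W (RInt W (- l) l).
Proof.
  intros Hl CW W0 Wz.
  assert (Chasles : forall x y z, RInt W x z = RInt W x y + RInt W y z).
  { intros x y z. symmetry. apply (RInt_Chasles W); now apply cont_ex_RInt. }
  assert (Pos : forall x y, x <= y -> 0 <= RInt W x y).
  { intros x y Hxy. apply RInt_ge_0; auto using cont_ex_RInt. }
  assert (Zero : forall x y, (forall z, Rmin x y < z < Rmax x y -> l <= Rabs z) ->
    RInt W x y = 0).
  { intros x y H. rewrite (RInt_ext W (fun _ => 0)).
    - rewrite RInt_const. unfold scal; simpl; unfold mult; simpl; ring.
    - intros z Hz. apply Wz, H, Hz. }
  assert (B : forall x, 0 <= RInt W (- l) x <= RInt W (- l) l).
  { intros x. destruct (Rle_dec x (- l)) as [H|H].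
    - rewrite Zero; [split; [lra|apply Pos; lra]|].
      intros z. rewrite Rmin_right, Rmax_left by lra. intros Hz.
      rewrite Rabs_left1; lra.
    - destruct (Rle_dec x l) as [H'|H'].
      + split; [apply Pos; lra|]. rewrite (Chasles (- l) x l).
        pose proof (Pos x l H'). lra.
      + rewrite (Chasles (- l) l x), (Zero l x).
        * pose proof (Pos (- l) l). lra.
        * intros z. rewrite Rmin_left, Rmax_right by lra. intros Hz.
          rewrite Rabs_right; lra. }
  intros x y.
  pose proof (B x). pose proof (B y). pose proof (Chasles (- l) x y).
  apply Rabs_le. lra.
Qed.

(** The factor 2 accounts for the two half-axes. *)
Lemma mass_weight (a L : R) : 0 <= L ->
  mass_le (weight a L) (2 * Rpower 2 (Rabs a) * RInt (bracket a) 0 (L + 1)).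
Proof.
  intros HL.
  assert (CW : forall x, continuous (weight a L) x).
  { intros x. exact (is_derive_continuous _ _ _ (is_derive_weight a L x)). }
  assert (Cb : forall x, continuous (fun x => Rpower 2 (Rabs a) * bracket a x) x).
  { intros x. apply (continuous_scal_r (Rpower 2 (Rabs a)) (bracket a)), continuous_bracket. }
  assert (Le : forall x, weight a L x <= Rpower 2 (Rabs a) * bracket a x).
  { intros x. unfold weight. pose proof (japanese_power_le a x).
    pose proof (Rpower_pos (japanese x) (- a)). pose proof (cutoff_range L x). nra. }
  assert (M : mass_le (weight a L) (RInt (weight a L) (- (L + 1)) (L + 1))).
  { apply mass_le_compact; auto; [lra| |].
    - intros x. apply Rmult_le_pos; [apply Rlt_le, Rpower_pos|apply cutoff_range].
    - intros x Hx. unfold weight. rewrite (proj1 (cutoff_zero L x Hx)). ring. }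
  assert (B : RInt (weight a L) (- (L + 1)) (L + 1) <=
    2 * Rpower 2 (Rabs a) * RInt (bracket a) 0 (L + 1)).
  { apply Rle_trans with (RInt (fun x => Rpower 2 (Rabs a) * bracket a x) (- (L + 1)) (L + 1)).
    - apply RInt_le; auto using cont_ex_RInt. lra.
    - rewrite RInt_scal_cont by apply continuous_bracket.
      rewrite <- (RInt_Chasles (bracket a) (- (L + 1)) 0 (L + 1))
        by apply cont_ex_RInt, continuous_bracket.
      assert (E : RInt (bracket a) (- (L + 1)) 0 = RInt (bracket a) 0 (L + 1)).
      { assert (E := RInt_comp_lin (bracket a) (-1) 0 0 (L + 1)
          (cont_ex_RInt _ _ _ (continuous_bracket a))).
        replace (-1 * 0 + 0) with 0 in E by ring.
        replace (-1 * (L + 1) + 0) with (- (L + 1)) in E by ring.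
        rewrite <- (opp_RInt_swap (bracket a) 0 (- (L + 1)))
          by apply cont_ex_RInt, continuous_bracket.
        rewrite <- E.
        change (- RInt (fun y => -1 * bracket a (-1 * y + 0)) 0 (L + 1) =
          RInt (bracket a) 0 (L + 1)).
        rewrite (RInt_ext _ (fun y => -1 * bracket a y)).
        2:{ intros y _. unfold bracket.
            replace (-1 * y + 0) with (- y) by ring. now rewrite Rabs_Ropp. }
        rewrite RInt_scal_cont by apply continuous_bracket. ring. }
      rewrite E. unfold plus; simpl. right; ring. }
  intros x y. eapply Rle_trans; [apply M|apply B].
Qed.

Lemma mass_weight_deriv (a L : R) : 0 <= L ->
  exists K, mass_le (fun x => Rabs (weight_deriv a L x)) K.
Proof.
  intros HL. eexists. apply (mass_le_compact _ (L + 1)).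
  - lra.
  - intros x. apply (continuous_comp (weight_deriv a L) Rabs).
    apply continuous_weight_deriv. apply continuous_Rabs.
  - intros x. apply Rabs_pos.
  - intros x Hx. unfold weight_deriv. destruct (cutoff_zero L x Hx) as [-> ->].
    rewrite !Rmult_0_r, Rplus_0_l. apply Rabs_R0.
Qed.

Lemma RInt_bracket_ne_1 (a l : R) : a <> 1 -> 0 <= l ->
  RInt (bracket a) 0 l = (Rpower (1 + l) (1 - a) - 1) / (1 - a).
Proof.
  intros Ha Hl. apply is_RInt_unique.
  replace ((Rpower (1 + l) (1 - a) - 1) / (1 - a)) with
    (minus (Rpower (1 + l) (1 - a) / (1 - a)) (Rpower (1 + 0) (1 - a) / (1 - a))).
  2:{ rewrite Rplus_0_r. unfold Rpower at 2. rewrite ln_1, Rmult_0_r, exp_0.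
      unfold minus, plus, opp; simpl. field. lra. }
  apply (is_RInt_derive (fun x => Rpower (1 + x) (1 - a) / (1 - a)) (bracket a)).
  - intros x. rewrite Rmin_left, Rmax_right by lra. intros Hx.
    unfold bracket. rewrite Rabs_right by lra.
    unfold Rpower. auto_derive; [lra|].
    replace (exp (- a * ln (1 + x))) with (exp ((1 - a) * ln (1 + x)) * / (1 + x)).
    + field. lra.
    + replace ((1 - a) * ln (1 + x)) with (- a * ln (1 + x) + ln (1 + x)) by ring.
      rewrite exp_plus, exp_ln by lra. field. lra.
  - intros x _. apply continuous_bracket.
Qed.

Lemma RInt_bracket_1 (l : R) : 0 <= l -> RInt (bracket 1) 0 l = ln (1 + l).
Proof.
  intros Hl. apply is_RInt_unique.
  replace (ln (1 + l)) with (minus (ln (1 + l)) (ln (1 + 0))).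
  2:{ rewrite Rplus_0_r, ln_1. unfold minus, plus, opp; simpl. ring. }
  apply (is_RInt_derive (fun x => ln (1 + x)) (bracket 1)).
  - intros x. rewrite Rmin_left, Rmax_right by lra. intros Hx.
    unfold bracket. rewrite Rabs_right by lra.
    rewrite Rpower_Ropp, Rpower_1 by lra.
    auto_derive; [lra|]. field. lra.
  - intros x _. apply continuous_bracket.
Qed.

(** * Initial data and lifespan *)

Lemma vanish_Derive (f : R -> R) (r : R) :
  (forall x, r < Rabs x -> f x = 0) -> forall x, r < Rabs x -> Derive f x = 0.
Proof.
  intros H x Hx. rewrite (Derive_ext_loc f (fun _ => 0)).
  - apply Derive_const.
  - apply (filter_imp (fun y => r < Rabs y)); auto.
    apply (continuous_Rabs x). apply (open_gt r), Hx.
Qed.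

Lemma vanish_bounded (f : R -> R) (r : R) :
  (forall x, continuous f x) -> (forall x, r < Rabs x -> f x = 0) ->
  exists M, 0 <= M /\ forall x, Rabs (f x) <= M.
Proof.
  intros Hc H.
  destruct (continuity_ab_maj (fun x => Rabs (f x)) (- Rabs r) (Rabs r)) as [z [Hz _]].
  - pose proof (Rabs_pos r). lra.
  - intros c _. apply continuity_pt_filterlim.
    apply (continuous_comp f Rabs); auto. apply continuous_Rabs.
  - exists (Rabs (f z)). split; [apply Rabs_pos|]. intros x.
    destruct (Rle_dec (Rabs x) (Rabs r)) as [Hx|Hx].
    + apply Hz. now apply Rabs_le_between.
    + rewrite H, Rabs_R0; [apply Rabs_pos|]. pose proof (Rle_abs r). lra.
Qed.

Lemma supp_vanish (f : R -> R) (r : R) :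
  included (supp f) (fun x => Rabs x <= r) -> forall x, r < Rabs x -> f x = 0.
Proof.
  intros H x Hx. destruct (Req_dec (f x) 0) as [|N]; auto.
  assert (Rabs x <= r) by now apply H, adherence_P1. lra.
Qed.

(** Here [m] bounds [|f'| + |g|] and is positive even for zero data, and
    the iteration takes place in the ball of radius [2 m eps].  The condition on
    [D] is [J q <= 1/2] with [q = p (2 m eps)^(p-1)].  The solution of the
    truncated equation solves the original one up to time [T]: outside
    [|x| <= Rad + T] both right-hand sides vanish, inside it the cutoff is 1. *)
Lemma solution_exists_if_small (p a Rad : R) (f g : R -> R) :
  1 < p -> 1 <= Rad -> Ck 2 f -> Ck 1 g ->
  (forall x, Rad < Rabs x -> f x = 0) -> (forall x, Rad < Rabs x -> g x = 0) ->
  exists D, 0 < D /\ forall eps T, 0 < eps -> 0 < T ->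
    D * Rpower eps (p - 1) * RInt (bracket a) 0 (Rad + T + 1) <= 1 ->
    exists u, classical_solution p a eps f g T u.
Proof.
  intros hp hR hf hg zf zg.
  assert (F0 : forall x, is_derive f x (Derive f x)).
  { intros x. apply Derive_correct, (hf 1%nat (le_S _ _ (le_n _)) x). }
  assert (F1 : forall x, is_derive (Derive f) x (Derive_n f 2 x)).
  { intros x. apply (Derive_correct (Derive f)), (hf 2%nat (le_n _) x). }
  assert (F2 : forall x, continuous (Derive_n f 2) x).
  { intros x. apply (hf 2%nat (le_n _) x). }
  assert (G0 : forall x, is_derive g x (Derive g x)).
  { intros x. apply Derive_correct, (hg 1%nat (le_n _) x). }
  assert (G1 : forall x, continuous (Derive g) x).
  { intros x. apply (hg 1%nat (le_n _) x). }
  assert (zf1 := vanish_Derive f Rad zf).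
  assert (zf2 := vanish_Derive (Derive f) Rad zf1).
  assert (zg1 := vanish_Derive g Rad zg).
  destruct (vanish_bounded (Derive f) Rad) as [mf [mf0 Hmf]]; auto.
  { intros x. exact (is_derive_continuous _ _ _ (F1 x)). }
  destruct (vanish_bounded g Rad) as [mg [mg0 Hmg]]; auto.
  { intros x. exact (is_derive_continuous _ _ _ (G0 x)). }
  destruct (vanish_bounded (Derive_n f 2) Rad) as [mf2 [mf20 Hmf2]]; auto.
  destruct (vanish_bounded (Derive g) Rad) as [mg1 [mg10 Hmg1]]; auto.
  set (m := mf + mg + 1). assert (Hm : 0 < m) by (unfold m; lra).
  exists (4 * Rpower 2 (Rabs a) * p * Rpower (2 * m) (p - 1)).
  split.
  { repeat apply Rmult_lt_0_compat; try apply Rpower_pos; lra. }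
  intros eps T He HT small.
  destruct (mass_weight_deriv a (Rad + T)) as [K HK]; [lra|].
  destruct (global_solution (fun x => eps * f x) (fun x => eps * Derive f x)
    (fun x => eps * Derive_n f 2 x) (fun x => eps * g x) (fun x => eps * Derive g x)
    (weight a (Rad + T)) (weight_deriv a (Rad + T))
    (fun s => abs_pow s p) (abs_pow_deriv p)
    (2 * m * eps) (eps * (mf2 + mg1))
    (2 * Rpower 2 (Rabs a) * RInt (bracket a) 0 (Rad + T + 1)) K
    (p * Rpower (2 * m * eps) (p - 1)) Rad)
    as (u & ux & ut & uxx & uxt & utt & C & Eq & I0 & I1 & S); auto.
  - intros x. apply (is_derive_scal f), F0.
  - intros x. apply (is_derive_scal (Derive f)), F1.
  - intros x. apply (continuous_scal_r eps (Derive_n f 2)), F2.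
  - intros x. apply (is_derive_scal g), G0.
  - intros x. apply (continuous_scal_r eps (Derive g)), G1.
  - intros x y. rewrite !Rabs_mult, (Rabs_right eps) by lra.
    pose proof (Hmf x). pose proof (Hmg y). unfold m. nra.
  - intros x y. rewrite !Rabs_mult, (Rabs_right eps) by lra.
    pose proof (Hmf2 x). pose proof (Hmg1 y). nra.
  - intros x Hx. rewrite zf1 by auto. ring.
  - intros x Hx. rewrite zg by auto. ring.
  - apply is_derive_weight.
  - apply continuous_weight_deriv.
  - intros x. apply Rmult_le_pos; [apply Rlt_le, Rpower_pos|apply cutoff_range].
  - apply mass_weight. lra.
  - intros s. now apply is_derive_abs_pow.
  - intros s. now apply continuous_abs_pow_deriv.
  - apply abs_pow_0.
  - intros s Hs. apply abs_pow_deriv_bound; auto.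
    repeat apply Rmult_lt_0_compat; lra.
  - rewrite <- Rpower_mult_distr by lra.
    match goal with |- ?z <= _ => replace z with
      (/ 2 * (4 * Rpower 2 (Rabs a) * p * Rpower (2 * m) (p - 1) * Rpower eps (p - 1)
        * RInt (bracket a) 0 (Rad + T + 1))) by field end.
    lra.
  - exists u. split; [exact (C2_plane_strip T _ _ _ _ _ _ C)|].
    destruct C. exists ux, ut, uxx, utt.
    split; [now apply is_derive_is_dx|]. split; [now apply is_derive_is_dt|].
    split; [now apply is_derive_is_dx|]. split; [now apply is_derive_is_dt|].
    split; [|split; auto].
    intros x t Ht. rewrite Eq.
    destruct (Rle_dec (Rabs x) (Rad + T)) as [Hx|Hx].
    + unfold weight. rewrite cutoff_one, Rpower_Ropp by auto.
      unfold Rdiv. ring.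
    + rewrite S by (rewrite (Rabs_right t); lra). rewrite abs_pow_0. unfold Rdiv. ring.
Qed.

(** [eps2] is chosen so small that [Rad + 2] is below the lifespan bound [X]; then
    [Rad + T + 2 <= 2 X], and [C] is what the smallness condition allows for
    [2 X].  For [a > 1] the mass is bounded by [1 / (a - 1)] for every [T]. *)
Lemma lifespan_small (p a Rad D : R) : 1 < p -> 1 <= Rad -> 0 < D ->
  exists eps2 C : R, 0 < eps2 /\ 0 < C /\
    forall eps T, 0 < eps <= eps2 -> 0 < T ->
      Rbar_lt (Finite T) (lifespan_bound p a C eps) ->
      D * Rpower eps (p - 1) * RInt (bracket a) 0 (Rad + T + 1) <= 1.
Proof.
  intros hp hR HD. unfold lifespan_bound.
  destruct (Rlt_dec a 1) as [Ha|Ha]; [|destruct (Req_EM_T a 1) as [Ha1|Ha1]].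
  - set (b := 1 - a). assert (Hb : 0 < b) by (unfold b; lra).
    set (C := Rpower (b / D) (/ b) / 2).
    assert (HC : 0 < C) by (unfold C; pose proof (Rpower_pos (b / D) (/ b)); lra).
    set (k := (p - 1) / b). assert (Hk : 0 < k) by (apply Rdiv_lt_0_compat; lra).
    exists (Rpower (C / (Rad + 2)) (/ k)), C.
    split; [apply Rpower_pos|]. split; auto.
    intros eps T [He Hee] HT H. simpl in H.
    replace (- (p - 1) / b) with (- k) in H by (unfold k; field; lra).
    rewrite RInt_bracket_ne_1 by lra. fold b.
    assert (E1 : Rpower eps k <= C / (Rad + 2)).
    { apply Rpower_le_of_le_root; auto. apply Rdiv_lt_0_compat; lra. }
    pose proof (Rpower_pos eps k) as Pk.
    assert (E2 : Rad + 2 <= C * Rpower eps (- k)).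
    { rewrite Rpower_Ropp. apply Rmult_le_reg_r with (Rpower eps k); auto.
      rewrite Rmult_assoc, Rinv_l, Rmult_1_r by lra.
      apply Rmult_le_compat_r with (r := Rad + 2) in E1; [|lra].
      replace (C / (Rad + 2) * (Rad + 2)) with C in E1 by (field; lra). lra. }
    assert (E3 : Rpower (1 + (Rad + T + 1)) b <= b / D * Rpower eps (- (p - 1))).
    { apply Rle_trans with (Rpower (2 * C * Rpower eps (- k)) b).
      - apply Rle_Rpower_l; lra.
      - replace (2 * C) with (Rpower (b / D) (/ b)) by (unfold C; field).
        rewrite <- Rpower_mult_distr by apply Rpower_pos.
        rewrite !Rpower_mult, Rinv_l, Rpower_1; try lra.
        + replace (- k * b) with (- (p - 1)) by (unfold k; field; lra). lra.
        + apply Rdiv_lt_0_compat; lra. }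
    pose proof (Rpower_pos eps (p - 1)) as Pe.
    rewrite Rpower_Ropp in E3.
    apply Rle_trans with (D * Rpower eps (p - 1) * ((b / D * / Rpower eps (p - 1)) / b)).
    + apply Rmult_le_compat_l; [apply Rlt_le, Rmult_lt_0_compat; auto|].
      apply Rmult_le_compat_r; [apply Rlt_le, Rinv_0_lt_compat; auto|]. lra.
    + right. field. lra.
  - subst a. set (C := / (2 * D)).
    assert (HC : 0 < C) by (apply Rinv_0_lt_compat; lra).
    set (k := p - 1). assert (Hk : 0 < k) by (unfold k; lra).
    assert (Hln : 0 < ln (Rad + 2)).
    { rewrite <- ln_1. apply ln_increasing; lra. }
    exists (Rpower (C / ln (Rad + 2)) (/ k)), C.
    split; [apply Rpower_pos|]. split; auto.
    intros eps T [He Hee] HT H. simpl in H. fold k in H.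
    rewrite RInt_bracket_1 by lra.
    assert (E1 : Rpower eps k <= C / ln (Rad + 2)).
    { apply Rpower_le_of_le_root; auto. apply Rdiv_lt_0_compat; lra. }
    pose proof (Rpower_pos eps k) as Pk.
    set (y := C * Rpower eps (- k)) in *.
    assert (Ey : y * Rpower eps k = C).
    { unfold y. rewrite Rpower_Ropp. field. lra. }
    assert (E2 : ln (Rad + 2) <= y).
    { apply Rmult_le_reg_r with (Rpower eps k); auto. rewrite Ey.
      apply Rmult_le_compat_r with (r := ln (Rad + 2)) in E1; [|lra].
      replace (C / ln (Rad + 2) * ln (Rad + 2)) with C in E1 by (field; lra). lra. }
    assert (E3 : Rad + 2 <= exp y).
    { rewrite <- (exp_ln (Rad + 2)) by lra.
      destruct E2 as [E2|E2]; [left; now apply exp_increasing|right; now rewrite E2]. }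
    assert (E4 : ln (1 + (Rad + T + 1)) <= 2 * y).
    { rewrite <- (ln_exp (2 * y)). apply ln_le; [lra|].
      replace (2 * y) with (y + y) by ring. rewrite exp_plus.
      assert (2 * exp y <= exp y * exp y) by (apply Rmult_le_compat_r; lra). lra. }
    apply Rle_trans with (D * (2 * C)); [|right; unfold C; field; lra].
    rewrite Rmult_assoc. apply Rmult_le_compat_l; [lra|].
    rewrite <- Ey.
    replace (2 * (y * Rpower eps k)) with (Rpower eps k * (2 * y)) by ring.
    apply Rmult_le_compat_l; lra.
  - assert (Ha2 : 0 < a - 1) by lra.
    exists (Rpower ((a - 1) / D) (/ (p - 1))), 1.
    split; [apply Rpower_pos|]. split; [lra|].
    intros eps T [He Hee] HT _.
    rewrite RInt_bracket_ne_1 by lra.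
    assert (E1 : Rpower eps (p - 1) <= (a - 1) / D).
    { apply Rpower_le_of_le_root; auto; [lra|]. apply Rdiv_lt_0_compat; lra. }
    pose proof (Rpower_pos eps (p - 1)) as Pe.
    pose proof (Rpower_pos (1 + (Rad + T + 1)) (1 - a)) as PI.
    assert (E2 : (Rpower (1 + (Rad + T + 1)) (1 - a) - 1) / (1 - a) <= / (a - 1)).
    { replace ((Rpower (1 + (Rad + T + 1)) (1 - a) - 1) / (1 - a)) with
        ((1 - Rpower (1 + (Rad + T + 1)) (1 - a)) * / (a - 1)) by (field; lra).
      rewrite <- (Rmult_1_l (/ (a - 1))) at 2.
      apply Rmult_le_compat_r; [apply Rlt_le, Rinv_0_lt_compat; auto|lra]. }
    apply Rle_trans with (D * ((a - 1) / D) * / (a - 1)).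
    + apply Rle_trans with (D * Rpower eps (p - 1) * / (a - 1)).
      * apply Rmult_le_compat_l; auto. apply Rlt_le, Rmult_lt_0_compat; auto.
      * apply Rmult_le_compat_r; [apply Rlt_le, Rinv_0_lt_compat; auto|].
        apply Rmult_le_compat_l; lra.
    + right. field. lra.
Qed.

Theorem theorem2p3 (p a Rad : R) (f g : R -> R)
  (hp : 1 < p) (hRad : 1 <= Rad)
  (hf : C0k 2 f) (hg : C0k 1 g)
  (hfsupp : included (supp f) (fun x => Rabs x <= Rad))
  (hgsupp : included (supp g) (fun x => Rabs x <= Rad)) :
  exists eps2 C : R, 0 < eps2 /\ 0 < C /\
    forall eps : R, 0 < eps <= eps2 ->
    forall T : R, 0 < T -> Rbar_lt (Finite T) (lifespan_bound p a C eps) ->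
    exists u : R -> R -> R, classical_solution p a eps f g T u.
Proof.
  destruct (solution_exists_if_small p a Rad f g hp hRad (proj1 hf) (proj1 hg)
    (supp_vanish f Rad hfsupp) (supp_vanish g Rad hgsupp)) as [D [HD Hex]].
  destruct (lifespan_small p a Rad D hp hRad HD) as (eps2 & C & He2 & HC & Hsmall).
  exists eps2, C. split; [exact He2|]. split; [exact HC|].
  intros eps He T HT Hlt. apply Hex; [apply He | exact HT |]. now apply Hsmall.
Qed.
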